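(* For every $\boldsymbol{\mathit{ba}\ell}$-algebra $A$, the pair $(D(\mathbb R[B]),\alpha)$ is a canonical extension of $A$: $\alpha:A\to D(\mathbb R[B])$ is an injective $\boldsymbol{\mathit{ba}\ell}$-morphism that is dense and compact.
   Context: A $\boldsymbol{\mathit{ba}\ell}$-algebra is a commutative unital lattice-ordered algebra $A$ over $\mathbb R$ that is bounded (for every $a\in A$ there is an integer $n\ge1$ with $a\le n\cdot1$) and archimedean (if $na\le b$ for all $n\ge1$ then $a\le0$); reals $r$ are identified with $r\cdot1$; $\boldsymbol{\mathit{ba}\ell}$-morphisms are unital $\ell$-algebra homomorphisms. For $a\in A$: $a^+=a\vee0$, $a^-=(-a)\vee0$. An $\ell$-ideal is a ring ideal $I$ with $|a|\le|b|$, $b\in I\Rightarrow a\in I$; it is archimedean if $A/I$ is archimedean. ${\sf Arch}(A)$ is the set of archimedean $\ell$-ideals ordered by inclusion, a bounded distributive lattice (a frame) with meet $\cap$ and join $I\vee J$ the least archimedean $\ell$-ideal containing $I\cup J$. $B$ is the free boolean extension of the bounded distributive lattice ${\sf Arch}(A)$; ${\sf Arch}(A)\subseteq B$ and $\lnot$ is complement in $B$. For a boolean algebra $B$, $\mathbb R[B]$ is the quotient of $\mathbb R[x_e\mid e\in B]$ by the ideal generated by $x_{e\wedge f}-x_ex_f$, $x_{e\vee f}-(x_e+x_f-x_ex_f)$, $x_{\lnot e}-(1-x_e)$, $x_0$; it is a $\boldsymbol{\mathit{ba}\ell}$-algebra. $D(\mathbb R[B])$ is its Dedekind completion (Dedekind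 complete $\boldsymbol{\mathit{ba}\ell}$-algebra containing $\mathbb R[B]$, every element a join of elements of $\mathbb R[B]$). $\alpha(a)=-s+\bigvee\{rx_{\lnot I}\mid r\in\mathbb R,\ I\in{\sf Arch}(A),\ (a+s-r)^-\in I\}$ for any $s\in\mathbb R$ with $a+s\ge0$ (well defined, independent of $s$). For a $\boldsymbol{\mathit{ba}\ell}$-algebra $A$, a Dedekind complete $\boldsymbol{\mathit{ba}\ell}$-algebra $D$ and an injective $\boldsymbol{\mathit{ba}\ell}$-morphism $\zeta:A\to D$: $\zeta$ is compact if whenever $S,T\subseteq A$ and $\varepsilon>0$ with $\bigwedge\zeta[S]+\varepsilon\le\bigvee\zeta[T]$, there are finite $S_0\subseteq S$, $T_0\subseteq T$ with $\bigwedge S_0\le\bigvee T_0$; $\zeta$ is dense if each element of $D$ is a join of meets of elements of $\zeta[A]$; $(D,\zeta)$ is a canonical extension of $A$ if $\zeta$ is dense and compact. *)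

(* Defs.v *)
From HB Require Import structures.
From mathcomp Require Import all_boot all_order all_algebra.
From mathcomp Require Import reals.
From Stdlib Require Import ClassicalEpsilon.
Set Implicit Arguments. Unset Strict Implicit. Unset Printing Implicit Defensive.
Import Order.TTheory GRing.Theory Num.Theory.
Local Open Scope ring_scope.

Definition is_ub (T : Type) (le : T -> T -> Prop) (X : T -> Prop) (u : T) :=
  forall x, X x -> le x u.
Definition is_lb (T : Type) (le : T -> T -> Prop) (X : T -> Prop) (u : T) :=
  forall x, X x -> le u x.
Definition is_lub (T : Type) (le : T -> T -> Prop) (X : T -> Prop) (d : T) :=
  is_ub le X d /\ forall u, is_ub le X u -> le d u.
Definition is_glb (T : Type) (le : T -> T -> Prop) (X : T -> Prop) (d : T) :=
  is_lb le X d /\ forall u, is_lb le X u -> le u d.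

Definition is_bal (R : realType) (A : comAlgType R) (le : A -> A -> Prop)
    (meet join : A -> A -> A) : Prop :=
  (forall a, le a a) /\
  (forall a b, le a b -> le b a -> a = b) /\
  (forall a b c, le a b -> le b c -> le a c) /\
  (forall a b, [/\ le (meet a b) a, le (meet a b) b &
                forall c, le c a -> le c b -> le c (meet a b)]) /\
  (forall a b, [/\ le a (join a b), le b (join a b) &
                forall c, le a c -> le b c -> le (join a b) c]) /\
  (forall a b c, le a b -> le (a + c) (b + c)) /\
  (forall a b, le 0 a -> le 0 b -> le 0 (a * b)) /\
  (forall (r : R) a, 0 <= r -> le 0 a -> le 0 (r *: a)) /\
  (forall a, exists n : nat, (1 <= n)%N /\ le a n%:R) /\
  (forall a b, (forall n : nat, (1 <= n)%N -> le (a *+ n) b) -> le a 0).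

Record balg (R : realType) := BAlg {
  bcar :> comAlgType R;
  ble : bcar -> bcar -> Prop;
  bmeet : bcar -> bcar -> bcar;
  bjoin : bcar -> bcar -> bcar;
  bal_ax : is_bal ble bmeet bjoin
}.
Arguments ble {R} b _ _.
Arguments bmeet {R} b _ _.
Arguments bjoin {R} b _ _.

Section Bal.
Variable R : realType.

Definition negpart (A : balg R) (a : A) : A := bjoin A (- a) 0.
Definition babs (A : balg R) (a : A) : A := bjoin A a (- a).

Definition bal_morph (A A' : balg R) (f : A -> A') : Prop :=
  (forall a b, f (a + b) = f a + f b) /\
  (forall (r : R) a, f (r *: a) = r *: f a) /\
  (forall a b, f (a * b) = f a * f b) /\
  f 1 = 1 /\
  (forall a b, f (bmeet A a b) = bmeet A' (f a) (f b)) /\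
  (forall a b, f (bjoin A a b) = bjoin A' (f a) (f b)).

Definition is_lideal (A : balg R) (I : A -> Prop) : Prop :=
  [/\ I 0,
      (forall a b, I a -> I b -> I (a + b)),
      (forall a, I a -> I (- a)),
      (forall a b, I b -> I (a * b)) &
      (forall a b, ble A (babs a) (babs b) -> I b -> I a)].

(* the order of the quotient A/I: [a] <= [b] iff a <= b + i for some i in I *)
Definition quot_le (A : balg R) (I : A -> Prop) (a b : A) : Prop :=
  exists i, I i /\ ble A a (b + i).

(* archimedean l-ideal: A/I is archimedean *)
Definition is_arch_ideal (A : balg R) (I : A -> Prop) : Prop :=
  is_lideal I /\
  forall a b, (forall n : nat, (1 <= n)%N -> quot_le I (a *+ n) b) -> quot_le I a 0.

Definition arch_meet (A : balg R) (I J : A -> Prop) : A -> Prop :=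
  fun a => I a /\ J a.
Definition arch_join (A : balg R) (I J : A -> Prop) : A -> Prop :=
  fun a => forall K, is_arch_ideal K -> (forall y, I y \/ J y -> K y) -> K a.
Definition arch_bot (A : balg R) : A -> Prop :=
  fun a => forall K, is_arch_ideal K -> K a.
Definition arch_top (A : balg R) : A -> Prop := fun _ => True.

(* f is a bounded lattice homomorphism Arch(A) -> C (f is only relevant on Arch(A)) *)
Definition arch_hom (A : balg R) (dC : Order.disp_t) (C : ctbDistrLatticeType dC)
    (f : (A -> Prop) -> C) : Prop :=
  [/\ (forall I J, is_arch_ideal I -> is_arch_ideal J ->
         f (arch_meet I J) = Order.meet (f I) (f J)),
      (forall I J, is_arch_ideal I -> is_arch_ideal J ->
         f (arch_join I J) = Order.join (f I) (f J)),
      f (@arch_bot A) = Order.bottom &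
      f (@arch_top A) = Order.top].

Definition bool_hom (d1 : Order.disp_t) (B1 : ctbDistrLatticeType d1)
    (d2 : Order.disp_t) (B2 : ctbDistrLatticeType d2) (g : B1 -> B2) : Prop :=
  [/\ (forall a b, g (Order.meet a b) = Order.meet (g a) (g b)),
      (forall a b, g (Order.join a b) = Order.join (g a) (g b)),
      (forall a, g (Order.compl a) = Order.compl (g a)),
      g Order.bottom = Order.bottom &
      g Order.top = Order.top].

Definition free_bool_ext (A : balg R) (dB : Order.disp_t)
    (B : ctbDistrLatticeType dB) (e : (A -> Prop) -> B) : Prop :=
  arch_hom e /\
  forall (dC : Order.disp_t) (C : ctbDistrLatticeType dC) (f : (A -> Prop) -> C),
    arch_hom f ->
    (exists g : B -> C, bool_hom g /\ forall I, is_arch_ideal I -> g (e I) = f I) /\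
    (forall g1 g2 : B -> C, bool_hom g1 -> bool_hom g2 ->
       (forall I, is_arch_ideal I -> g1 (e I) = g2 (e I)) -> forall b, g1 b = g2 b).

Definition RB_relations (dB : Order.disp_t) (B : ctbDistrLatticeType dB)
    (T : comAlgType R) (x : B -> T) : Prop :=
  [/\ (forall e f, x (Order.meet e f) = x e * x f),
      (forall e f, x (Order.join e f) = x e + x f - x e * x f),
      (forall e, x (Order.compl e) = 1 - x e) &
      x Order.bottom = 0].

Definition alg_hom (T1 T2 : comAlgType R) (g : T1 -> T2) : Prop :=
  [/\ (forall a b, g (a + b) = g a + g b),
      (forall (r : R) a, g (r *: a) = r *: g a),
      (forall a b, g (a * b) = g a * g b) &
      g 1 = 1].

(* (S, x) is R[B] = R[x_e | e in B] / (relations), as a ba\ell-algebra: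
   the universal commutative R-algebra generated by the x_e subject to the relations *)
Definition is_RB (dB : Order.disp_t) (B : ctbDistrLatticeType dB)
    (S : balg R) (x : B -> S) : Prop :=
  RB_relations x /\
  forall (T : comAlgType R) (y : B -> T), RB_relations y ->
    (exists g : S -> T, alg_hom g /\ forall e, g (x e) = y e) /\
    (forall g1 g2 : S -> T, alg_hom g1 -> alg_hom g2 ->
       (forall e, g1 (x e) = g2 (x e)) -> forall s, g1 s = g2 s).

Definition dedekind_complete (D : balg R) : Prop :=
  (forall X : D -> Prop, (exists x, X x) -> (exists u, is_ub (ble D) X u) ->
     exists d, is_lub (ble D) X d) /\
  (forall X : D -> Prop, (exists x, X x) -> (exists u, is_lb (ble D) X u) ->
     exists d, is_glb (ble D) X d).

Definition dedekind_completion (S D : balg R) (iota : S -> D) : Prop :=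
  [/\ dedekind_complete D, injective iota, bal_morph iota &
      forall d : D, exists X : S -> Prop,
        is_lub (ble D) (fun y => exists s, X s /\ y = iota s) d].

(* finite meets / joins of nonempty finite families *)
Definition fin_meet (A : balg R) (a0 : A) (s : seq A) : A := foldr (bmeet A) a0 s.
Definition fin_join (A : balg R) (a0 : A) (s : seq A) : A := foldr (bjoin A) a0 s.

Definition image (A D : balg R) (z : A -> D) (X : A -> Prop) : D -> Prop :=
  fun y => exists a, X a /\ y = z a.

Definition compact_emb (A D : balg R) (z : A -> D) : Prop :=
  forall (S T : A -> Prop) (eps : R) (m j : D), 0 < eps ->
    is_glb (ble D) (image z S) m -> is_lub (ble D) (image z T) j ->
    ble D (m + eps%:A) j ->
    exists (s0 : A) (S0 : seq A) (t0 : A) (T0 : seq A),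
      [/\ S s0, (forall s, s \in S0 -> S s), T t0, (forall t, t \in T0 -> T t) &
          ble A (fin_meet s0 S0) (fin_join t0 T0)].

Definition dense_emb (A D : balg R) (z : A -> D) : Prop :=
  forall d : D, exists X : D -> Prop,
    is_lub (ble D) X d /\
    forall y, X y -> exists Z : A -> Prop, is_glb (ble D) (image z Z) y.

Definition canonical_extension (A D : balg R) (z : A -> D) : Prop :=
  [/\ dedekind_complete D, injective z, bal_morph z, dense_emb z & compact_emb z].

Definition lubD (D : balg R) (X : D -> Prop) : D :=
  epsilon (inhabits (0 : D)) (fun d => is_lub (ble D) X d).

Definition alpha_set (A : balg R) (dB : Order.disp_t) (B : ctbDistrLatticeType dB)
    (e : (A -> Prop) -> B) (S : balg R) (x : B -> S) (D : balg R) (iota : S -> D)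
    (a : A) (s : R) : D -> Prop :=
  fun y => exists (r : R) (I : A -> Prop),
    [/\ is_arch_ideal I, I (negpart (a + s%:A - r%:A)) &
        y = r *: iota (x (Order.compl (e I)))].

Definition alpha (A : balg R) (dB : Order.disp_t) (B : ctbDistrLatticeType dB)
    (e : (A -> Prop) -> B) (S : balg R) (x : B -> S) (D : balg R) (iota : S -> D)
    (a : A) : D :=
  let s := epsilon (inhabits (0 : R)) (fun s : R => ble A 0 (a + s%:A)) in
  - (s%:A) + lubD (alpha_set e x iota a s).

End Bal.

(* Main.v *)
Require Import Defs.
From HB Require Import structures.
From mathcomp Require Import all_boot all_order all_algebra.
From mathcomp Require Import reals.
From mathcomp Require Import boolp classical_sets.
From mathcomp Require Import ring lra.
From Stdlib Require Import ClassicalEpsilon.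

(** The points of [A] are the unital l-algebra homomorphisms [A -> R]. Maximal
    l-ideals have residue field [R], so by Zorn's lemma there are enough points:
    they separate every archimedean l-ideal from the elements outside it.
    Sending an ideal to the set of points at which it does not vanish therefore
    represents [B] faithfully by sets of points; under this representation the
    complement of the kernel of a point [p] is the atom [{p}]. Consequently every [d] in
    the Dedekind completion satisfies [d * x_p = v p d *: x_p] for a unique real
    [v p d], and the maps [v p] identify the completion with the bounded
    functions on points, joins and meets being computed pointwise. There
    [alpha a] is the function [p |-> p a], so injectivity, density and compactness
    become statements about functions: density is the separation of points, and
    compactness is the fact that an l-ideal contained in the kernel of no point
    contains [1]. *)

Set Implicit Arguments. Unset Strict Implicit. Unset Printing Implicit Defensive.
Import Order.TTheory Order.CTheory GRing.Theory Num.Theory.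
Local Open Scope ring_scope.

Local Notation "a <<= b" := (ble _ a b) (at level 70).

(** * Order arithmetic and l-ideals of a bal-algebra *)

Section LatticeAlgebra.
Variables (R : realType) (A : balg R).
Implicit Types (a b c d : A) (r s : R) (n : nat).

Lemma ble_refl a : a <<= a.
Proof. by have [H _] := bal_ax A. Qed.

Lemma ble_anti a b : a <<= b -> b <<= a -> a = b.
Proof. by have [_ [H _]] := bal_ax A; apply: H. Qed.

Lemma ble_trans b a c : a <<= b -> b <<= c -> a <<= c.
Proof. by have [_ [_ [H _]]] := bal_ax A; apply: H. Qed.

Lemma bmeetP a b : [/\ bmeet A a b <<= a, bmeet A a b <<= b &
  forall c, c <<= a -> c <<= b -> c <<= bmeet A a b].
Proof. by have [_ [_ [_ [H _]]]] := bal_ax A; apply: H. Qed.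

Lemma bjoinP a b : [/\ a <<= bjoin A a b, b <<= bjoin A a b &
  forall c, a <<= c -> b <<= c -> bjoin A a b <<= c].
Proof. by have [_ [_ [_ [_ [H _]]]]] := bal_ax A; apply: H. Qed.

Lemma bleDr c a b : a <<= b -> a + c <<= b + c.
Proof. by have [_ [_ [_ [_ [_ [H _]]]]]] := bal_ax A; apply: H. Qed.

Lemma bmul_ge0 a b : 0 <<= a -> 0 <<= b -> 0 <<= a * b.
Proof. by have [_ [_ [_ [_ [_ [_ [H _]]]]]]] := bal_ax A; apply: H. Qed.

Lemma bscale_ge0 r a : 0 <= r -> 0 <<= a -> 0 <<= r *: a.
Proof. by have [_ [_ [_ [_ [_ [_ [_ [H _]]]]]]]] := bal_ax A; apply: H. Qed.

Lemma bbounded a : exists n : nat, (1 <= n)%N /\ a <<= n%:R.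
Proof. by have [_ [_ [_ [_ [_ [_ [_ [_ [H _]]]]]]]]] := bal_ax A; apply: H. Qed.

Lemma barch a b :
  (forall n : nat, (1 <= n)%N -> a *+ n <<= b) -> a <<= 0.
Proof. by have [_ [_ [_ [_ [_ [_ [_ [_ [_ H]]]]]]]]] := bal_ax A; apply: H. Qed.

Lemma bsub_ge0 a b : a <<= b <-> 0 <<= b - a.
Proof.
split=> [/(@bleDr (- a))|/(@bleDr a)]; first by rewrite subrr.
by rewrite subrK add0r.
Qed.

Lemma badd_ge0 a b : 0 <<= a -> 0 <<= b -> 0 <<= a + b.
Proof. by move=> a0 /(@bleDr a); rewrite add0r addrC; exact: ble_trans a0. Qed.

Lemma bleD a b c d : a <<= b -> c <<= d -> a + c <<= b + d.
Proof.
move=> /bsub_ge0 ab /bsub_ge0 cd; apply/bsub_ge0.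
have -> : b + d - (a + c) = (b - a) + (d - c) by ring.
exact: badd_ge0.
Qed.

Lemma bleN a b : a <<= b -> - b <<= - a.
Proof. by move=> /bsub_ge0 ab; apply/bsub_ge0; rewrite opprK addrC. Qed.

Lemma bleMl c a b : 0 <<= c -> a <<= b -> c * a <<= c * b.
Proof.
by move=> c0 /bsub_ge0 ab; apply/bsub_ge0; rewrite -mulrBr; exact: bmul_ge0.
Qed.

Lemma bleZ r a b : 0 <= r -> a <<= b -> r *: a <<= r *: b.
Proof.
by move=> r0 /bsub_ge0 ab; apply/bsub_ge0; rewrite -scalerBr; exact: bscale_ge0.
Qed.

Lemma bdouble_ge0 a : 0 <<= a + a -> 0 <<= a.
Proof.
move=> H; have := @bscale_ge0 2^-1 _ _ H; rewrite -mulr2n -scaler_nat scalerA.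
by rewrite mulVf ?pnatr_eq0// scale1r; apply; rewrite invr_ge0 ler0n.
Qed.

(** Boundedness applied to [0] gives [0 <<= n] for some [n >= 1]; divide by [n]. *)
Lemma ble01 : (0 : A) <<= 1.
Proof.
have [n [n1 n0]] := bbounded 0; case: n n1 n0 => // n _ n0.
have := @bscale_ge0 (n.+1%:R^-1) _ _ n0; rewrite -scaler_nat scalerA.
by rewrite mulVf ?pnatr_eq0// scale1r; apply; rewrite invr_ge0 ler0n.
Qed.

Lemma ble_alg r s : r <= s -> (r%:A : A) <<= s%:A.
Proof.
move=> rs; apply/bsub_ge0; rewrite -scalerBl; apply: bscale_ge0 ble01.
by rewrite subr_ge0.
Qed.

Lemma balg_nat n : (n%:R%:A : A) = n%:R.
Proof. by rewrite scaler_nat. Qed.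

Lemma bnat_ge0 n : (0 : A) <<= n%:R.
Proof. by have := @ble_alg 0 n%:R (ler0n _ n); rewrite scale0r balg_nat. Qed.

Lemma balg_le0 r : (r%:A : A) <<= 0 -> r <= 0.
Proof.
move=> H; rewrite leNgt; apply/negP => r0.
have := @bleZ r^-1 _ _ _ H; rewrite scalerA mulVf ?lt0r_neq0// scale1r scaler0.
rewrite invr_ge0 ltW// => /(_ isT) H1.
by have /eqP := oner_neq0 A; apply; exact: ble_anti H1 ble01.
Qed.

Lemma bmeetE a b : bmeet A a b = - bjoin A (- a) (- b).
Proof.
have [m1 m2 m3] := bmeetP a b; have [j1 j2 j3] := bjoinP (- a) (- b).
apply: ble_anti.
  by rewrite -[X in X <<= _]opprK; apply/bleN/j3; exact: bleN.
by apply: m3; [rewrite -[X in _ <<= X](opprK a)|rewrite -[X in _ <<= X](opprK b)];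
  exact: bleN.
Qed.

Definition pospart a := bjoin A a 0.

Lemma pospart_ge0 a : 0 <<= pospart a.
Proof. by have [] := bjoinP a 0. Qed.

Lemma pospart_ge a : a <<= pospart a.
Proof. by have [] := bjoinP a 0. Qed.

Lemma negpart_ge0 a : 0 <<= negpart a.
Proof. by have [] := bjoinP (- a) 0. Qed.

Lemma negpart_ge a : - a <<= negpart a.
Proof. by have [] := bjoinP (- a) 0. Qed.

Lemma negpartE a : negpart a = pospart (- a).
Proof. by []. Qed.

Lemma pospart_eq0 a : a <<= 0 -> pospart a = 0.
Proof.
have [_ j0 jl] := bjoinP a 0; move=> a0; apply: ble_anti => //.
by apply: jl => //; exact: ble_refl.
Qed.

Lemma pospart_subneg a : pospart a - negpart a = a.
Proof.
have [p1 p2 p3] := bjoinP a 0; have [n1 n2 n3] := bjoinP (- a) 0.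
apply: ble_anti; apply/bsub_ge0.
  have : pospart a <<= a + negpart a.
    apply: p3; first by rewrite -[X in X <<= _]addr0; apply: bleD => //; exact: ble_refl.
    by rewrite -(subrr a); apply: bleD => //; exact: ble_refl.
  by move/bsub_ge0; congr (_ <<= _); ring.
have : negpart a <<= pospart a - a.
  apply: n3; first by rewrite -[X in X <<= _]add0r; exact: bleDr.
  by rewrite -(subrr a); exact: bleDr.
by move/bsub_ge0; congr (_ <<= _); ring.
Qed.

(** If [N] bounds both factors, [a * b] lies below [N *: a] and [N *: b], so [N^-1 *: (a * b)] is a
    common lower bound of [a] and [b]. *)
Lemma bdisjoint_mul a b : 0 <<= a -> 0 <<= b ->
  (forall c, c <<= a -> c <<= b -> c <<= 0) -> a * b = 0.
Proof.
move=> a0 b0 ab.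
have [n [n1 an]] := bbounded a; have [m [m1 bm]] := bbounded b.
pose N : R := (n + m)%:R.
have N0 : 0 < N by rewrite ltr0n addn_gt0 n1.
have le1 : a * b <<= N *: a.
  rewrite -mulr_algl mulrC mulrC [X in _ <<= X]mulrC balg_nat natrD.
  apply: bleMl => //; apply: ble_trans bm _.
  by rewrite -[X in X <<= _]add0r; apply: bleDr; exact: bnat_ge0.
have le2 : a * b <<= N *: b.
  rewrite -mulr_algl mulrC [X in _ <<= X]mulrC balg_nat natrD.
  apply: bleMl => //; apply: ble_trans an _; rewrite addrC.
  by rewrite -[X in X <<= _]add0r; apply: bleDr; exact: bnat_ge0.
have NV : 0 <= N^-1 by rewrite invr_ge0 ltW.
have scaled c : N^-1 *: (N *: c) = c by rewrite scalerA mulVf ?scale1r// lt0r_neq0.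
have H : N^-1 *: (a * b) <<= 0.
  by apply: ab; [have := bleZ NV le1|have := bleZ NV le2]; rewrite scaled.
apply: ble_anti; last exact: bmul_ge0.
by have := bleZ (ltW N0) H; rewrite scaler0 scalerA divff ?lt0r_neq0// scale1r.
Qed.

(** For a common lower bound [c] of the two parts, [pospart a - c] is still above [a] and [0], hence
    above [pospart a], which forces [c <<= 0]. *)
Lemma posneg_mul0 a : pospart a * negpart a = 0.
Proof.
apply: bdisjoint_mul; [exact: pospart_ge0|exact: negpart_ge0|move=> c cp cn].
have [_ _ jl] := bjoinP a 0.
have /bsub_ge0 : pospart a <<= pospart a - c.
  apply: jl; last by move/bsub_ge0: cp.
  rewrite -[X in X <<= _](pospart_subneg a).
  by apply: bleD; [exact: ble_refl|exact: bleN].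
by move=> H; apply/bsub_ge0; move: H; congr (_ <<= _); ring.
Qed.

Lemma babs_ge a : a <<= babs a.
Proof. by have [] := bjoinP a (- a). Qed.

Lemma babs_geN a : - a <<= babs a.
Proof. by have [] := bjoinP a (- a). Qed.

Lemma babs_le a c : a <<= c -> - a <<= c -> babs a <<= c.
Proof. by have [_ _] := bjoinP a (- a); apply. Qed.

Lemma babs_ge0 a : 0 <<= babs a.
Proof.
apply: bdouble_ge0.
by rewrite -(subrr a); apply: bleD; [exact: babs_ge|exact: babs_geN].
Qed.

Lemma bge0_abs a : 0 <<= a -> babs a = a.
Proof.
move=> a0; apply: ble_anti (babs_ge a); apply: babs_le (ble_refl a) _.
by apply: (ble_trans _ a0); rewrite -oppr0; exact: bleN.
Qed.

Lemma babsN a : babs (- a) = babs a.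
Proof.
by apply: ble_anti; apply: babs_le; rewrite ?opprK; try exact: babs_geN;
  try exact: babs_ge; rewrite -[X in X <<= _]opprK; exact: babs_geN.
Qed.

Lemma babsD a b : babs (a + b) <<= babs a + babs b.
Proof.
by apply: babs_le; rewrite ?opprD; apply: bleD;
  first [exact: babs_ge|exact: babs_geN].
Qed.

(** The differences [|a||b| - ab] and [|a||b| + ab], once doubled, are sums of two products of
    nonnegative elements. *)
Lemma babsM a b : babs (a * b) <<= babs a * babs b.
Proof.
have p c : 0 <<= babs c - c by have /bsub_ge0 := babs_ge c.
have q c : 0 <<= babs c + c.
  by have /bsub_ge0 := babs_geN c; rewrite opprK.
apply: babs_le; apply/bsub_ge0/bdouble_ge0.
  rewrite [X in _ <<= X](_ : _ = (babs a - a) * (babs b + b)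
    + (babs a + a) * (babs b - b)); last by ring.
  by apply: badd_ge0; exact: bmul_ge0.
rewrite [X in _ <<= X](_ : _ = (babs a - a) * (babs b - b)
    + (babs a + a) * (babs b + b)); last by ring.
by apply: badd_ge0; exact: bmul_ge0.
Qed.

Lemma bbounded_abs a : exists n : nat, babs a <<= n%:R.
Proof. by have [n []] := bbounded (babs a); exists n. Qed.

Lemma lideal_le (I : A -> Prop) a b :
  is_lideal I -> I b -> - b <<= a -> a <<= b -> I a.
Proof.
move=> [_ _ _ _ Isol] Ib ba ab; apply: Isol Ib.
apply: ble_trans (babs_ge b); apply: babs_le => //.
by rewrite -[X in _ <<= X]opprK; exact: bleN.
Qed.

Lemma lideal_ge0_le (I : A -> Prop) a b :
  is_lideal I -> I b -> 0 <<= a -> a <<= b -> I a.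
Proof.
move=> HI Ib a0 ab; apply: (lideal_le HI Ib) => //.
by apply: (ble_trans _ a0); rewrite -oppr0; apply: bleN; exact: ble_trans a0 ab.
Qed.

Lemma lideal_abs (I : A -> Prop) a : is_lideal I -> I a -> I (babs a).
Proof.
move=> [_ _ _ _ Isol] Ia; apply: Isol Ia.
by rewrite bge0_abs; [exact: ble_refl|exact: babs_ge0].
Qed.

Lemma lidealZ (I : A -> Prop) r a : is_lideal I -> I a -> I (r *: a).
Proof. by move=> [_ _ _ IM _] Ia; rewrite -mulr_algl; exact: IM. Qed.

Lemma lidealB (I : A -> Prop) a b : is_lideal I -> I a -> I b -> I (a - b).
Proof. by move=> [_ ID IN _ _] Ia Ib; apply: ID => //; exact: IN. Qed.

(** Absorption comes from boundedness: [babs a <<= n] turns a bound [g] for [b] into the bound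
    [g *+ n] for [a * b]. *)
Lemma cone_lideal (G : A -> Prop) :
  G 0 -> (forall a b, G a -> G b -> G (a + b)) ->
  is_lideal (fun a => exists g, G g /\ babs a <<= g).
Proof.
move=> G0 GD; split.
- by exists 0; split=> //; rewrite bge0_abs; exact: ble_refl.
- move=> a b [g [Gg ag]] [h [Gh bh]]; exists (g + h); split; first exact: GD.
  by apply: ble_trans (babsD _ _) _; exact: bleD.
- by move=> a [g [Gg ag]]; exists g; rewrite babsN.
- move=> a b [g [Gg bg]]; have [n an] := bbounded_abs a; exists (g *+ n); split.
    by elim: n {an} => [|n IH]; rewrite ?mulr0n// mulrS; exact: GD.
  apply: ble_trans (babsM a b) _.
  apply: (@ble_trans (n%:R * babs b)).
    by rewrite mulrC [X in _ <<= X]mulrC; apply: bleMl an; exact: babs_ge0.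
  by rewrite -[g *+ n]mulr_natl; apply: bleMl bg; exact: bnat_ge0.
- by move=> a b ab [g [Gg bg]]; exists g; split=> //; exact: ble_trans ab bg.
Qed.

(** For [v >= 0] this is the l-ideal generated by [I] and [v]; integer multiples of [v] suffice
    because [A] is bounded. *)
Definition lideal_adjoin (I : A -> Prop) v : A -> Prop :=
  fun a => exists g, (exists i n, I i /\ g = i + v *+ n) /\ babs a <<= g.

Lemma lideal_adjoinP (I : A -> Prop) v : is_lideal I -> is_lideal (lideal_adjoin I v).
Proof.
move=> [I0 ID _ _ _]; apply: cone_lideal; first by exists 0, 0%N; rewrite mulr0n addr0.
move=> _ _ [i [n [Ii ->]]] [j [m [Ij ->]]]; exists (i + j), (n + m)%N.
by split; [exact: ID|rewrite mulrnDr; ring].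
Qed.

Lemma lideal_adjoin_sub (I : A -> Prop) v a :
  is_lideal I -> I a -> lideal_adjoin I v a.
Proof.
move=> HI Ia; exists (babs a); split; last exact: ble_refl.
by exists (babs a), 0%N; rewrite mulr0n addr0; split=> //; exact: lideal_abs.
Qed.

Lemma lideal_adjoin_abs (I : A -> Prop) a :
  is_lideal I -> lideal_adjoin I (babs a) a.
Proof.
move=> [I0 _ _ _ _]; exists (babs a); split; last exact: ble_refl.
by exists 0, 1%N; rewrite add0r mulr1n.
Qed.

(* Multiplying 1 <= i + n v by u kills the v-term, leaving u <= u i in I. *)
Lemma disjoint_adjoin_proper (I : A -> Prop) u v : is_lideal I ->
  0 <<= u -> u * v = 0 -> ~ I u -> ~ lideal_adjoin I v 1.
Proof.
move=> HI u0 uv nIu [_ [[i [n [Ii ->]]]]]; rewrite bge0_abs; last exact: ble01.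
move=> /(bleMl u0); rewrite mulr1 mulrDr mulrnAr uv mul0rn addr0 => H.
by apply: nIu; have [_ _ _ IM _] := HI; apply: lideal_ge0_le (IM u i Ii) u0 H.
Qed.

Lemma maximal_lideal_exists (J : A -> Prop) : is_lideal J -> ~ J 1 ->
  exists M : A -> Prop, [/\ is_lideal M, ~ M 1, forall a, J a -> M a &
    forall K : A -> Prop, is_lideal K -> ~ K 1 -> (forall a, M a -> K a) ->
      forall a, K a -> M a].
Proof.
move=> HJ nJ1.
(* Requiring [J] together with [M], rather than [M], to be a proper l-ideal lets the empty union of
   the empty chain qualify. *)
pose P (M : set A) := is_lideal (J `|` M)%classic /\ ~ (J `|` M)%classic 1.
have [F FP Ftot|M [[HM nM1] Mmax]] := @Zorn_bigcup A P.
  (* Any two elements of the union lie in one l-ideal inside it, so the closure conditions pass to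
     the union. *)
  have two a b : (J `|` \bigcup_(X in F) X)%classic a ->
      (J `|` \bigcup_(X in F) X)%classic b ->
      exists K : set A, [/\ is_lideal K, K a, K b &
        (K `<=` J `|` \bigcup_(X in F) X)%classic].
    have sub X : F X -> (J `|` X `<=` J `|` \bigcup_(X in F) X)%classic.
      by move=> FX c [|Xc]; [left|right; exists X].
    move=> [Ja|[X FX Xa]] [Jb|[Y FY Yb]].
    - by exists J; split=> // c; left.
    - by exists (J `|` Y)%classic; split; [exact: (FP _ FY).1|left|right|exact: sub].
    - by exists (J `|` X)%classic; split; [exact: (FP _ FX).1|right|left|exact: sub].
    - case: (Ftot _ _ FX FY) => XY.
        by exists (J `|` Y)%classic; split; [exact: (FP _ FY).1|right; exact: XY|right|exact: sub].
      by exists (J `|` X)%classic; split; [exact: (FP _ FX).1|right|right; exact: XY|exact: sub].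
  split; last first.
    move=> [//|[X FX X1]]; have [_] := FP _ FX; apply.
    by right.
  have [J0 _ _ _ _] := HJ; split; first by left.
  - by move=> a b Ka Kb; have [K [[_ KD _ _ _] ? ? KJ]] := two _ _ Ka Kb; apply/KJ/KD.
  - by move=> a Ka; have [K [[_ _ KN _ _] ? ? KJ]] := two _ _ Ka Ka; apply/KJ/KN.
  - by move=> a b Ka; have [K [[_ _ _ KM _] ? ? KJ]] := two _ _ Ka Ka; apply/KJ/KM.
  - move=> a b ab Ka; have [K [[_ _ _ _ KS] ? ? KJ]] := two _ _ Ka Ka.
    by apply/KJ; exact: KS ab _.
exists (J `|` M)%classic; split=> //; first by move=> a; left.
move=> K HK nK1 MK a Ka; apply: contrapT => nMa.
have JK : (J `|` K)%classic = K.
  by apply/seteqP; split=> [c [Jc|//]|c]; [apply: MK; left|right].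
apply: (Mmax K); last by rewrite /P JK.
split=> [c Mc|E]; first by apply: MK; right.
by apply: nMa; right; exact: E.
Qed.

End LatticeAlgebra.

(** * Maximal l-ideals, real-valued points and separation *)

Section Points.
Variables (R : realType) (A : balg R).
Implicit Types (a b c d : A) (r s : R) (n : nat) (I J M : A -> Prop).

Definition is_point (p : A -> R) : Prop :=
  [/\ forall a b, p (a + b) = p a + p b,
      forall r a, p (r *: a) = r * p a,
      forall a b, p (a * b) = p a * p b,
      p 1 = 1 &
      forall a b, p (bjoin A a b) = Num.max (p a) (p b)].

Definition bpoint := {p : A -> R | is_point p}.
Definition pev (p : bpoint) : A -> R := sval p.
Coercion pev : bpoint >-> Funclass.

Lemma lideal_alg_eq0 M r : is_lideal M -> ~ M 1 -> M r%:A -> r = 0.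
Proof.
move=> HM nM1 Mr; apply/eqP/negPn/negP => r0; apply: nM1.
by have := lidealZ r^-1 HM Mr; rewrite scalerA mulVf// scale1r.
Qed.

Section MaximalIdeal.
Variable M : A -> Prop.
Hypotheses (HM : is_lideal M) (nM1 : ~ M 1).
Hypothesis Mmax : forall K : A -> Prop, is_lideal K -> ~ K 1 ->
  (forall a, M a -> K a) -> forall a, K a -> M a.

(** If [pospart a] is outside [M], disjointness keeps [M] proper after adjoining [negpart a], and
    maximality applies. Thus [A/M] is totally ordered. *)
Lemma maximal_posneg a : M (pospart a) \/ M (negpart a).
Proof.
have [|nMp] := pselect (M (pospart a)); [by left|right].
have nK1 := disjoint_adjoin_proper HM (pospart_ge0 a) (posneg_mul0 a) nMp.
apply: (Mmax (lideal_adjoinP _ HM) nK1 (fun b => lideal_adjoin_sub _ HM)).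
rewrite -{1}(bge0_abs (negpart_ge0 a)); exact: lideal_adjoin_abs.
Qed.

(** If [a] were outside [M], maximality would give [1 <<= i + n |a|] with [i] in [M], which fails
    for [a] infinitesimal modulo [M]. *)
Lemma maximal_closed a :
  (forall r, 0 < r -> exists m, M m /\ babs a <<= r%:A + m) -> M a.
Proof.
move=> H; apply: contrapT => nMa.
have [M0 MD _ _ _] := HM.
have [[_ [[i [n [Mi ->]]]]]|nK1] := pselect (lideal_adjoin M (babs a) 1); last first.
  apply: nMa; apply: (Mmax (lideal_adjoinP _ HM) nK1).
    by move=> b; exact: lideal_adjoin_sub.
  exact: lideal_adjoin_abs.
rewrite bge0_abs; last exact: ble01.
case: n => [|n].
  rewrite mulr0n addr0 => i1.
  by apply: nM1; exact: lideal_ge0_le HM Mi (@ble01 R A) i1.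
(* [n.+1] copies of this bound add up to [1/2], leaving [1/2] below an element of [M]. *)
have [m [Mm am]] := H (2 * n.+1%:R)^-1 ltac:(by rewrite invr_gt0 mulr_gt0 ?ltr0n).
move=> i1; apply: nM1.
have half : (2^-1%:A : A) <<= i + m *+ n.+1.
  have : babs a *+ n.+1 <<= (2 * n.+1%:R)^-1%:A *+ n.+1 + m *+ n.+1.
    rewrite -mulrnDl -[X in X <<= _]mulr_natl -[X in _ <<= X]mulr_natl; apply: bleMl am; exact: bnat_ge0.
  rewrite -[(2 * n.+1%:R)^-1%:A *+ n.+1]scaler_nat scalerA invfM mulrCA.
  rewrite divff ?pnatr_eq0// mulr1 => /(bleD (ble_refl i)) /(ble_trans i1).
  move=> /(bleDr (- 2^-1%:A)).
  have -> : 1 - 2^-1%:A = 2^-1%:A :> A.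
    by rewrite -[X in X - _]scale1r -scalerBl; congr (_ *: _); field.
  by congr (_ <<= _); ring.
have Mim : M (i + m *+ n.+1).
  by apply: MD => //; rewrite -scaler_nat; exact: lidealZ.
have := lidealZ 2 HM Mim => M2.
apply: lideal_ge0_le HM M2 (@ble01 R A) _.
have := @bleZ R A 2 _ _ ltac:(by []) half.
by rewrite scalerA divff ?pnatr_eq0// scale1r.
Qed.

(** The residue is the supremum of the reals lying below [a] modulo [M]; the difference is
    infinitesimal, so [maximal_closed] applies. *)
Lemma maximal_residue a : exists r, M (a - r%:A).
Proof.
pose E : set R := [set r | M (negpart (a - r%:A))]%classic.
have [M0 MD MN _ _] := HM.
have [n [_ an]] := bbounded a; have [m [_ am]] := bbounded (- a).
have Em : E (- m%:R).
  rewrite /E /= negpartE pospart_eq0// scaleNr opprK balg_nat opprD.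
  by have := bleDr (- m%:R) am; rewrite subrr.
have En : ubound E n%:R.
  move=> r Er; rewrite -subr_le0; apply: (@balg_le0 R A).
  have Mp : M (pospart ((r - n%:R)%:A : A)).
    apply: lideal_ge0_le HM Er (pospart_ge0 _) _.
    have [_ _ jl] := bjoinP ((r - n%:R)%:A : A) 0.
    apply: jl; last exact: negpart_ge0.
    apply: (ble_trans _ (negpart_ge _)); rewrite opprB scalerBl balg_nat.
    by apply: bleD; [exact: ble_refl|exact: bleN].
  have [r0|r0] := leP (r - n%:R) 0; first by have := ble_alg A r0; rewrite scale0r.
  have Mr : M (r - n%:R)%:A.
    apply: lideal_ge0_le HM Mp _ (pospart_ge _).
    by have := ble_alg A (ltW r0); rewrite scale0r.
  by rewrite (lideal_alg_eq0 HM nM1 Mr) scale0r; exact: ble_refl.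
have Esup : has_sup E by split; [exists (- m%:R)|exists n%:R].
exists (sup E); apply: maximal_closed => d d0.
(* [sup E + d] is outside [E], so [maximal_posneg] leaves only the positive part. *)
have Mp : M (pospart (a - (sup E + d)%:A)).
  have [//|Mn] := maximal_posneg (a - (sup E + d)%:A).
  have := ub_le_sup (proj2 Esup) Mn; lra.
have [r Er rd] := sup_adherent d0 Esup.
exists (pospart (a - (sup E + d)%:A) + negpart (a - r%:A)); split; first exact: MD.
apply: babs_le.
  have := bleD (pospart_ge (a - (sup E + d)%:A)) (negpart_ge0 (a - r%:A)).
  move=> /(bleDr d%:A); rewrite scalerDl; congr (_ <<= _); ring.
have := bleD (negpart_ge (a - r%:A)) (pospart_ge0 (a - (sup E + d)%:A)).
have := @ble_alg R A (sup E) (d + r) ltac:(by lra).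
move=> H1 /(bleD H1); rewrite scalerDl => /(bleDr (- r%:A)).
by congr (_ <<= _); ring.
Qed.

(** Residues modulo [M] are unique, so each identity for [p] reduces to a membership in [M]. *)
Lemma maximal_point : exists p, is_point p /\ forall a, M a -> p a = 0.
Proof.
have [M0 MD MN MM _] := HM.
have /choice[p Mp] := maximal_residue.
have uniq a r : M (a - r%:A) -> p a = r.
  move=> Mr; apply/eqP; rewrite -subr_eq0; apply/eqP/(lideal_alg_eq0 HM nM1).
  have := lidealB HM Mr (Mp a); rewrite scalerBl; congr M; ring.
exists p; split; last by move=> a Ma; apply: uniq; rewrite scale0r subr0.
split.
- move=> a b; apply: uniq; have := MD _ _ (Mp a) (Mp b).
  by rewrite scalerDl; congr M; ring.
- move=> r a; apply: uniq; have := lidealZ r HM (Mp a).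
  by rewrite scalerBr scalerA.
- move=> a b; apply: uniq; have := MD _ _ (MM b _ (Mp a)) (MM (p a)%:A _ (Mp b)).
  have -> : (p a * p b)%:A = (p a)%:A * (p b)%:A :> A.
    by rewrite mulr_algl scalerA.
  by congr M; ring.
- by apply: uniq; rewrite scale1r subrr.
- move=> a b; apply: uniq.
  (* Replacing [a] and [b] by their residues moves the join by at most [u + v], which lies in
     [M]. *)
  set u := babs (a - (p a)%:A); set v := babs (b - (p b)%:A).
  have Muv : M (u + v) by apply: MD; exact: lideal_abs.
  have [u0 v0] : 0 <<= u /\ 0 <<= v by split; exact: babs_ge0.
  have [j1 j2 j3] := bjoinP a b.
  have am : ((p a)%:A : A) <<= (Num.max (p a) (p b))%:A.
    by apply: ble_alg; rewrite le_max lexx.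
  have bm : ((p b)%:A : A) <<= (Num.max (p a) (p b))%:A.
    by apply: ble_alg; rewrite le_max lexx orbT.
  apply: lideal_le HM Muv _ _.
    suff /bsub_ge0 : (Num.max (p a) (p b))%:A <<= bjoin A a b + (u + v).
      by move=> H; apply/bsub_ge0; move: H; congr (_ <<= _); ring.
    case: leP => _.
      have := bleD (babs_geN (b - (p b)%:A)) (bleD j2 u0).
      by congr (_ <<= _); rewrite /v; ring.
    have := bleD (babs_geN (a - (p a)%:A)) (bleD j1 v0).
    by congr (_ <<= _); rewrite /u; ring.
  suff /bsub_ge0 : bjoin A a b <<= (Num.max (p a) (p b))%:A + (u + v).
    by move=> H; apply/bsub_ge0; move: H; congr (_ <<= _); ring.
  apply: j3.
    have := bleD (babs_ge (a - (p a)%:A)) (bleD am v0).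
    by congr (_ <<= _); rewrite /u; ring.
  have := bleD (babs_ge (b - (p b)%:A)) (bleD bm u0).
  by congr (_ <<= _); rewrite /v; ring.
Qed.

End MaximalIdeal.

Lemma point_exists J : is_lideal J -> ~ J 1 ->
  exists p : bpoint, forall a, J a -> p a = 0.
Proof.
move=> HJ nJ1; have [M [HM nM1 JM Mmax]] := maximal_lideal_exists HJ nJ1.
have [p [Hp pM]] := maximal_point HM nM1 Mmax.
by exists (exist _ p Hp) => a Ja; exact/pM/JM.
Qed.

Section PointTheory.
Variable p : bpoint.

Lemma pointD a b : p (a + b) = p a + p b.
Proof. by case: (svalP p) => H *; exact: H. Qed.
Lemma pointZ r a : p (r *: a) = r * p a.
Proof. by case: (svalP p) => _ H *; exact: H. Qed.
Lemma pointM a b : p (a * b) = p a * p b.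
Proof. by case: (svalP p) => _ _ H *; exact: H. Qed.
Lemma point1 : p 1 = 1.
Proof. by case: (svalP p). Qed.
Lemma point_join a b : p (bjoin A a b) = Num.max (p a) (p b).
Proof. by case: (svalP p) => _ _ _ _ H; exact: H. Qed.
Lemma point0 : p 0 = 0.
Proof. by rewrite -(scale0r (0 : A)) pointZ mul0r. Qed.
Lemma pointN a : p (- a) = - p a.
Proof. by rewrite -scaleN1r pointZ mulN1r. Qed.
Lemma pointB a b : p (a - b) = p a - p b.
Proof. by rewrite pointD pointN. Qed.
Lemma point_alg r : p r%:A = r.
Proof. by rewrite pointZ point1 mulr1. Qed.
Lemma point_nat n : p n%:R = n%:R.
Proof. by rewrite -balg_nat point_alg. Qed.
Lemma point_le a b : a <<= b -> p a <= p b.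
Proof.
move=> ab; have [_ j2 j3] := bjoinP a b.
have <- : bjoin A a b = b by apply: ble_anti => //; apply: j3 => //; exact: ble_refl.
by rewrite point_join le_max lexx.
Qed.
Lemma point_meet a b : p (bmeet A a b) = Num.min (p a) (p b).
Proof. by rewrite bmeetE pointN point_join !pointN -oppr_min opprK. Qed.
Lemma point_abs a : p (babs a) = `|p a|.
Proof.
rewrite point_join pointN; case: leP => h.
  by rewrite ler0_norm//; lra.
by rewrite ger0_norm//; lra.
Qed.
Lemma point_negpart a : p (negpart a) = Num.max (- p a) 0.
Proof. by rewrite point_join pointN point0. Qed.

Definition pker : A -> Prop := fun a => p a = 0.

Lemma pker_arch : is_arch_ideal pker.
Proof.
rewrite /pker; split.
  split; first exact: point0.
  - by move=> a b pa pb; rewrite pointD pa pb addr0.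
  - by move=> a pa; rewrite pointN pa oppr0.
  - by move=> a b pb; rewrite pointM pb mulr0.
  - move=> a b /point_le; rewrite !point_abs => ab pb; apply/eqP.
    by rewrite -normr_le0 (le_trans ab)// pb normr0.
move=> a b H; exists (pospart a); split; last by rewrite add0r; exact: pospart_ge.
rewrite point_join point0; apply/max_idPr; rewrite leNgt; apply/negP => pa.
pose n := (Num.truncn (p b / p a)).+1.
have [i [pi]] := H n isT; move/point_le; rewrite pointD pi addr0 -scaler_nat pointZ.
have : p b / p a < n%:R by exact: truncnS_gt.
by rewrite ltr_pdivrMr// ltNge => /negP.
Qed.

End PointTheory.

(** Some [(|a| - r)^+] with [r > 0] is outside [I]. Adjoining the disjoint [(|a| - r)^-] keeps [I]
    proper, and a point killing the result satisfies [|p a| >= r]. *)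
Lemma arch_separation I a : is_arch_ideal I -> ~ I a ->
  exists p : bpoint, (forall b, I b -> p b = 0) /\ p a <> 0.
Proof.
move=> [HI Iarch] nIa.
have nIb : ~ I (babs a).
  by have [_ _ _ _ IS] := HI; move=> H; apply: nIa; apply: IS H;
    rewrite [X in _ <<= X]bge0_abs; [exact: ble_refl|exact: babs_ge0].
(* Otherwise the choices [r = 1/n] give [n |a| <= 1] modulo [I] for all [n >= 1], and [|a|] is in
   [I] by archimedeanness. *)
have [r [r0 nIr]] : exists r, 0 < r /\ ~ I (pospart (babs a - r%:A)).
  apply: contrapT => N; apply: nIb.
  have [|i [Ii ai]] := Iarch (babs a) 1.
    move=> n n1; pose i := pospart (babs a - n%:R^-1%:A).
    have n0 : 0 < n%:R :> R by rewrite ltr0n.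
    exists (n%:R *: i); split.
      apply: lidealZ => //; apply: contrapT => nI; apply: N; exists n%:R^-1.
      by rewrite invr_gt0.
    have /(bleZ (ltW n0)) := pospart_ge (babs a - n%:R^-1%:A).
    rewrite scalerBr scalerA divff ?lt0r_neq0// scaler_nat scale1r => /(bleDr 1).
    by rewrite subrK [X in _ <<= X]addrC scaler_nat.
  by rewrite add0r in ai; exact: lideal_ge0_le HI Ii (babs_ge0 a) ai.
have nK1 := disjoint_adjoin_proper HI (pospart_ge0 _) (posneg_mul0 _) nIr.
have [p pK] := point_exists (lideal_adjoinP _ HI) nK1.
exists p; split=> [b Ib|pa0]; first by apply: pK; exact: lideal_adjoin_sub.
have := pK (negpart (babs a - r%:A)).
rewrite -{1}(bge0_abs (negpart_ge0 (babs a - r%:A))) => /(_ (lideal_adjoin_abs _ HI)).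
rewrite point_negpart pointB point_abs pa0 normr0 point_alg.
by case: leP => h; lra.
Qed.

(** This is the archimedean axiom of [A] itself; through [arch_separation] it makes the points
    detect the order. *)
Lemma zero_arch : is_arch_ideal (fun a : A => a = 0).
Proof.
split; first split=> //.
- by move=> a b -> ->; rewrite addr0.
- by move=> a ->; rewrite oppr0.
- by move=> a b ->; rewrite mulr0.
- move=> a b + b0; rewrite b0 (bge0_abs (ble_refl 0)) => H.
  apply: ble_anti; first exact: ble_trans (babs_ge a) H.
  by rewrite -[a]opprK -[X in X <<= _]oppr0; apply: bleN; exact: ble_trans (babs_geN a) H.
move=> a b H; exists 0; split=> //; rewrite addr0; apply: (@barch _ _ _ b) => n n1.
by have [_ [->]] := H n n1; rewrite addr0.
Qed.

Lemma ble_points a b : (forall p : bpoint, p a <= p b) -> a <<= b.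
Proof.
move=> H; suff : pospart (a - b) = 0.
  move=> E; have := pospart_ge (a - b); rewrite E => /(bleDr b).
  by rewrite subrK add0r.
apply: contrapT => /(arch_separation zero_arch)[p [_]]; apply.
by rewrite point_join pointB point0; apply/max_idPr; rewrite subr_le0.
Qed.

Lemma points_inj a b : (forall p : bpoint, p a = p b) -> a = b.
Proof. by move=> H; apply: ble_anti; apply: ble_points => p; rewrite H. Qed.

Lemma point_inhabited : exists p : bpoint, True.
Proof.
have [|p _] := @point_exists (fun a => a = 0) (proj1 zero_arch); last by exists p.
exact/eqP/oner_neq0.
Qed.

(** [a - (p a)%:A] is in the kernel of [p], hence in that of [q], so [q a = p a]. *)
Lemma pker_inj (p q : bpoint) : (forall a, p a = 0 -> q a = 0) -> p = q.
Proof.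
move=> H; have : sval p = sval q.
  apply/funext => a; have /H : p (a - (p a)%:A) = 0 by rewrite pointB point_alg subrr.
  by rewrite pointB point_alg => /subr0_eq E; exact: esym E.
by case: p q {H} => p Hp [q Hq] /= E; exact: eq_exist.
Qed.

End Points.

(** * Boolean subalgebras and induction over the free boolean extension *)

Section SubBooleanAlgebra.
Variables (dB : Order.disp_t) (B : ctbDistrLatticeType dB) (N : B -> Prop).

Definition subbool_closed : Prop :=
  [/\ N Order.top, forall b c, N b -> N c -> N (Order.meet b c) &
      forall b, N b -> N (Order.compl b)].

Hypothesis HN : subbool_closed.

Definition subbool := {b : B | `[<N b>]}.
HB.instance Definition _ := Choice.copy subbool {b : B | `[<N b>]}.
Implicit Types u v w : subbool.

Definition mk_subbool b (Nb : N b) : subbool := exist _ b (asboolT Nb).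

Lemma subboolP u : N (sval u).
Proof. exact/asboolP/(svalP u). Qed.

Lemma subbool_inj u v : sval u = sval v -> u = v.
Proof. by move=> E; exact: val_inj. Qed.

Lemma subbool_closed_join b c : N b -> N c -> N (Order.join b c).
Proof.
have [_ NM NC] := HN; move=> Nb Nc.
by rewrite -[Order.join b c]complK complU; apply/NC/NM; exact: NC.
Qed.

Lemma subbool_closed_bot : N Order.bottom.
Proof. by have [NT _ NC] := HN; rewrite -compl1; exact: NC. Qed.

Definition subbool_meet u v : subbool :=
  mk_subbool (let: And3 _ NM _ := HN in NM _ _ (subboolP u) (subboolP v)).
Definition subbool_join u v : subbool :=
  mk_subbool (subbool_closed_join (subboolP u) (subboolP v)).
Definition subbool_compl u : subbool :=
  mk_subbool (let: And3 _ _ NC := HN in NC _ (subboolP u)).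
Definition subbool_top : subbool := mk_subbool (let: And3 NT _ _ := HN in NT).
Definition subbool_bot : subbool := mk_subbool subbool_closed_bot.
Definition subbool_le u v : bool := subbool_meet u v == u.
Definition subbool_lt u v : bool := (v != u) && subbool_le u v.

Fact subbool_meetC : commutative subbool_meet.
Proof. by move=> u v; apply: subbool_inj; exact: meetC. Qed.
Fact subbool_joinC : commutative subbool_join.
Proof. by move=> u v; apply: subbool_inj; exact: joinC. Qed.
Fact subbool_meetA : associative subbool_meet.
Proof. by move=> u v w; apply: subbool_inj; exact: meetA. Qed.
Fact subbool_joinA : associative subbool_join.
Proof. by move=> u v w; apply: subbool_inj; exact: joinA. Qed.
Fact subbool_joinKI v u : subbool_meet u (subbool_join u v) = u.
Proof. by apply: subbool_inj; exact: joinKI. Qed.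
Fact subbool_meetKU v u : subbool_join u (subbool_meet u v) = u.
Proof. by apply: subbool_inj; exact: meetKU. Qed.
Fact subbool_meetUl : left_distributive subbool_meet subbool_join.
Proof. by move=> u v w; apply: subbool_inj; exact: meetUl. Qed.
Fact subbool_meetxx : idempotent_op subbool_meet.
Proof. by move=> u; apply: subbool_inj; exact: meetxx. Qed.

HB.instance Definition _ :=
  @Order.isMeetJoinDistrLattice.Build dB subbool subbool_le subbool_lt
    subbool_meet subbool_join (fun _ _ => erefl) (fun _ _ => erefl)
    subbool_meetC subbool_joinC subbool_meetA subbool_joinA
    subbool_joinKI subbool_meetKU subbool_meetUl subbool_meetxx.

Fact subbool_le0 u : (subbool_bot <= u)%O.
Proof. by rewrite leEmeet; apply/eqP/subbool_inj; exact: meet0x. Qed.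
Fact subbool_le1 u : (u <= subbool_top)%O.
Proof. by rewrite leEmeet; apply/eqP/subbool_inj; exact: meetx1. Qed.

HB.instance Definition _ := Order.hasBottom.Build dB subbool subbool_le0.
HB.instance Definition _ := Order.hasTop.Build dB subbool subbool_le1.

Fact subbool_joinxC u : Order.join u (subbool_compl u) = Order.top.
Proof. by apply: subbool_inj; exact: joinxC. Qed.
Fact subbool_meetxC u : Order.meet u (subbool_compl u) = Order.bottom.
Proof. by apply: subbool_inj; exact: meetxC. Qed.

HB.instance Definition _ := Order.TBDistrLattice_hasComplement.Build dB subbool
  subbool_joinxC subbool_meetxC.

(** The universal property maps [B] into the subalgebra [N], fixing every [e I]; by uniqueness,
    following this map by the inclusion gives the identity. *)
Lemma free_bool_ext_ind (R : realType) (A : balg R) (e : (A -> Prop) -> B) :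
  free_bool_ext e -> (forall I, is_arch_ideal I -> N (e I)) -> forall b, N b.
Proof.
move=> [[eM eJ e0 e1] univ] Ne b.
(* The default [subbool_top] is taken only where [e I] is outside [N], so never at an archimedean
   ideal. *)
pose f I : subbool := insubd subbool_top (e I).
have fE I : N (e I) -> sval (f I) = e I.
  by move=> NI; rewrite /f; apply: insubdK; exact: asboolT.
have Hf : arch_hom f.
  split=> [I J HI HJ|I J HI HJ||]; apply: subbool_inj.
  - transitivity (Order.meet (sval (f I)) (sval (f J))) => //.
    have [NI NJ] := (Ne _ HI, Ne _ HJ); rewrite !fE ?eM//.
    by have [_ NM _] := HN; exact: NM.
  - transitivity (Order.join (sval (f I)) (sval (f J))) => //.
    have [NI NJ] := (Ne _ HI, Ne _ HJ); rewrite !fE ?eJ//.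
    exact: subbool_closed_join.
  - by rewrite fE e0//; exact: subbool_closed_bot.
  - by rewrite fE e1//; have [] := HN.
have [[g [[gM gJ gC g0 g1] ge]] _] := univ _ _ f Hf.
have [_ uniq] := univ _ _ e (And4 eM eJ e0 e1).
suff <- : sval (g b) = b by exact: subboolP.
apply: (uniq (fun c => sval (g c)) id).
- by split=> [c d|c d|c||]; rewrite ?(gM, gJ, gC, g0, g1).
- by split.
- by move=> I HI /=; rewrite ge// fE//; exact: Ne.
Qed.

End SubBooleanAlgebra.

(** * Subalgebras and induction over [R[B]] *)

Section SubAlgebra.
Variables (R : realType) (S : balg R) (P : S -> Prop).

Definition subalg_pred : {pred S} := [pred s | `[<P s>]].

Hypothesis HP : GRing.subalg_closed subalg_pred.
HB.instance Definition _ := GRing.isSubalgClosed.Build R S subalg_pred HP.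
Definition subalg := {s : S | s \in subalg_pred}.
HB.instance Definition _ := SubChoice.copy subalg {s : S | s \in subalg_pred}.
HB.instance Definition _ := [SubChoice_isSubAlgebra of subalg by <:].
HB.instance Definition _ := [SubNzRing_isSubComNzRing of subalg by <:].

(** The homomorphism into the subalgebra [P] induced by the generators, followed by the inclusion,
    fixes all [x b], so it is the identity. *)
Lemma RB_ind (dB : Order.disp_t) (B : ctbDistrLatticeType dB) (x : B -> S) :
  is_RB x ->
  (forall b, P (x b)) -> forall s, P s.
Proof.
move=> [Hx univ] Px s; have [xM xJ xC x0] := Hx.
pose y b : subalg := exist _ (x b) (asboolT (Px b)).
have Hy : RB_relations y.
  by split=> [b c|b c|b|]; apply: val_inj => /=; rewrite ?rmorphB ?rmorphD ?rmorphM ?rmorph1 ?rmorph0 /= ?(xM, xJ, xC, x0).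
have [[g [[gD gZ gM g1] gx]] _] := univ subalg y Hy.
have [_ uniq] := univ S x Hx.
suff <- : val (g s) = s by exact/asboolP/(svalP (g s)).
apply: (uniq (fun t => val (g t)) id).
- by split=> [a b|r a|a b|]; rewrite ?gD ?gZ ?gM ?g1.
- by split.
- by move=> b; rewrite gx.
Qed.

End SubAlgebra.

(** * The lattice of archimedean ideals and its cozero sets *)

Section ArchimedeanIdeals.
Variables (R : realType) (A : balg R).
Implicit Types (I J K : A -> Prop) (a b : A).

(** The witness in [quot_le] becomes one that depends on [a] alone, so the archimedean condition
    passes to intersections. *)
Lemma lideal_quot_le0 I a : is_lideal I -> quot_le I a 0 <-> I (pospart a).
Proof.
move=> HI; split=> [[i [Ii]]|Ip]; last first.
  by exists (pospart a); split=> //; rewrite add0r; exact: pospart_ge.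
rewrite add0r => ai; apply: lideal_ge0_le HI (lideal_abs HI Ii) (pospart_ge0 a) _.
have [_ _] := bjoinP a 0; apply; last exact: babs_ge0.
exact: ble_trans ai (babs_ge i).
Qed.

Lemma arch_bigcap (Q : (A -> Prop) -> Prop) :
  is_arch_ideal (fun a => forall K, is_arch_ideal K -> Q K -> K a).
Proof.
have HI : is_lideal (fun a => forall K, is_arch_ideal K -> Q K -> K a).
  split=> [K [[]]//|a b Ha Hb K HK QK|a Ha K HK QK|a b Hb K HK QK|a b ab Hb K HK QK].
  - by have [[_ KD _ _ _] _] := HK; apply: KD; [exact: Ha|exact: Hb].
  - by have [[_ _ KN _ _] _] := HK; apply: KN; exact: Ha.
  - by have [[_ _ _ KM _] _] := HK; apply: KM; exact: Hb.
  - by have [[_ _ _ _ KS] _] := HK; apply: KS ab _; exact: Hb.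
split=> // a b H; apply/lideal_quot_le0 => // K HK QK.
have [HK1 Karch] := HK; apply/lideal_quot_le0 => //; apply: (Karch a b) => n n1.
by have [i [Hi ai]] := H n n1; exists i; split=> //; exact: Hi.
Qed.

Lemma arch_ideal_ext I J :
  is_arch_ideal I -> (forall a, I a <-> J a) -> is_arch_ideal J.
Proof. by move=> HI IJ; rewrite -(_ : I = J)//; apply/funext => a; exact/propext. Qed.

Lemma arch_joinP I J : is_arch_ideal (arch_join I J).
Proof. exact: arch_bigcap. Qed.

Lemma arch_meetP I J : is_arch_ideal I -> is_arch_ideal J ->
  is_arch_ideal (arch_meet I J).
Proof.
move=> HI HJ; apply: arch_ideal_ext (arch_bigcap (fun K => K = I \/ K = J)) _ => a.
split=> [H|[Ia Ja] K _ [->|->]//].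
by split; apply: H => //; [left|right].
Qed.

Lemma arch_botP : is_arch_ideal (@arch_bot R A).
Proof.
apply: arch_ideal_ext (arch_bigcap (fun _ => True)) _ => a.
by split=> [H K HK|H K HK _]; exact: H.
Qed.

Lemma arch_topP : is_arch_ideal (@arch_top R A).
Proof. by split=> // a b _; exists a; split=> //; rewrite add0r; exact: ble_refl. Qed.

Definition cozero I : set (bpoint A) := [set p | exists a, I a /\ p a <> 0]%classic.

(** For joins, a point off both cozero sets has an archimedean kernel containing [I] and [J], hence
    their join; for meets, the product of two witnesses is a witness. *)
Lemma cozero_arch_hom : arch_hom cozero.
Proof.
split=> [I J HI HJ|I J HI HJ||]; apply/seteqP; split=> p.
- by move=> [a [[Ia Ja] pa]]; split; exists a.
- move=> [[a [Ia /eqP pa]] [b [Jb /eqP pb]]]; exists (a * b).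
  have [[_ _ _ IM _] _] := HI; have [[_ _ _ JM _] _] := HJ.
  split; last by apply/eqP; rewrite pointM mulf_neq0.
  by split; [rewrite mulrC; exact: IM|exact: JM].
- move=> [a [Ha pa]]; apply: contrapT => N; apply: pa.
  apply: (Ha _ (pker_arch p)) => y Hy; apply: contrapT => py; apply: N.
  by case: Hy => Hy; [left|right]; exists y.
- by move=> [[a [Ia pa]]|[a [Ja pa]]]; exists a; split=> // K _; apply; [left|right].
- by move=> [a [Ha pa]]; apply: pa; exact: (Ha _ (pker_arch p)).
- by [].
- by [].
- by move=> _; exists 1; split=> //; rewrite point1; exact/eqP/oner_neq0.
Qed.

Lemma cozero_sub I J : is_arch_ideal J ->
  (cozero I `<=` cozero J)%classic -> forall a, I a -> J a.
Proof.
move=> HJ sub a Ia; apply: contrapT => /(arch_separation HJ)[p [pJ pa]].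
by have [|b [Jb]] := sub p _; [exists a|apply; exact: pJ].
Qed.

End ArchimedeanIdeals.

(** * Normal forms in [B] and its faithful representation by sets of points *)

Section FreeBooleanExtension.
Variables (R : realType) (A : balg R).
Variables (dB : Order.disp_t) (B : ctbDistrLatticeType dB) (e : (A -> Prop) -> B).
Hypothesis He : free_bool_ext e.

Definition locally_closed (I J : A -> Prop) : B :=
  Order.meet (e I) (Order.compl (e J)).

(** Finite joins of differences: the normal form in a boolean algebra generated by a sublattice. *)
Inductive constructible : B -> Prop :=
| constructible_bot : constructible Order.bottom
| constructible_join I J b : is_arch_ideal I -> is_arch_ideal J ->
    constructible b -> constructible (Order.join (locally_closed I J) b).

Lemma constructible_lc I J : is_arch_ideal I -> is_arch_ideal J ->
  constructible (locally_closed I J).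
Proof.
move=> HI HJ; rewrite -[locally_closed I J]joinx0.
by apply: constructible_join => //; exact: constructible_bot.
Qed.

Lemma constructibleU b c :
  constructible b -> constructible c -> constructible (Order.join b c).
Proof.
move=> Hb Hc; elim: Hb => [|I J d HI HJ _ IH]; first by rewrite join0x.
by rewrite -joinA; exact: constructible_join.
Qed.

(** The meet of the differences of [I, J] and of [I', J'] is the difference of [arch_meet I I'] and
    [arch_join J J']. *)
Lemma constructible_lcI I J b : is_arch_ideal I -> is_arch_ideal J ->
  constructible b -> constructible (Order.meet (locally_closed I J) b).
Proof.
move=> HI HJ; elim=> [|I' J' d HI' HJ' _ IH].
  by rewrite meetx0; exact: constructible_bot.
rewrite meetUr; apply: constructibleU => //.
have [[eM eJ _ _] _] := He.
have -> : Order.meet (locally_closed I J) (locally_closed I' J') =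
    locally_closed (arch_meet I I') (arch_join J J').
  by rewrite /locally_closed eM// eJ// complU meetACA.
by apply: constructible_lc; [exact: arch_meetP|exact: arch_joinP].
Qed.

Lemma constructibleI b c :
  constructible b -> constructible c -> constructible (Order.meet b c).
Proof.
move=> Hb Hc; elim: Hb => [|I J d HI HJ _ IH].
  by rewrite meet0x; exact: constructible_bot.
by rewrite meetUl; apply: constructibleU => //; exact: constructible_lcI.
Qed.

Lemma constructible_e I : is_arch_ideal I -> constructible (e I).
Proof.
move=> HI; have [[_ _ e0 _] _] := He.
have -> : e I = locally_closed I (@arch_bot R A).
  by rewrite /locally_closed e0 compl0 meetx1.
by apply: constructible_lc => //; exact: arch_botP.
Qed.

Lemma constructible_Ce I : is_arch_ideal I -> constructible (Order.compl (e I)).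
Proof.
move=> HI; have [[_ _ _ e1] _] := He.
have -> : Order.compl (e I) = locally_closed (@arch_top R A) I.
  by rewrite /locally_closed e1 meet1x.
by apply: constructible_lc => //; exact: arch_topP.
Qed.

Lemma constructible_top : constructible Order.top.
Proof.
by have [[_ _ _ <-] _] := He; apply: constructible_e; exact: arch_topP.
Qed.

Lemma constructibleC b : constructible b -> constructible (Order.compl b).
Proof.
elim=> [|I J c HI HJ _ IH]; first by rewrite compl0; exact: constructible_top.
rewrite complU; apply: constructibleI IH.
rewrite /locally_closed complI complK; apply: constructibleU.
  exact: constructible_Ce.
exact: constructible_e.
Qed.

Lemma constructibleT b : constructible b.
Proof.
apply: (free_bool_ext_ind _ He) b => [|I]; last exact: constructible_e.
by split; [exact: constructible_top|exact: constructibleI|exact: constructibleC].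
Qed.

(** By the normal form, faithfulness need only be checked on a difference: if its image is empty,
    separation gives [I] inside [J], and the difference is already bottom in [B]. *)
Lemma free_bool_ext_spatial : exists g : B -> set (bpoint A),
  [/\ bool_hom g, forall I, is_arch_ideal I -> g (e I) = cozero I &
      forall b, g b = set0 -> b = Order.bottom].
Proof.
have [[eM _ _ _] univ] := He.
have [[g [Hg ge]] _] := univ _ _ _ (cozero_arch_hom A).
exists g; split=> // b; have [gM gJ gC g0 g1] := Hg.
elim: (constructibleT b) => // I J c HI HJ _ IH; rewrite gJ => E.
have E1 : g (locally_closed I J) = set0.
  by apply/seteqP; split=> // p gp; rewrite -E; left.
have E2 : g c = set0 by apply/seteqP; split=> // p gp; rewrite -E; right.
rewrite (IH E2) joinx0 /locally_closed.
have IJ : forall a, I a -> J a.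
  apply: cozero_sub => // p Ip; apply: contrapT => nJp.
  suff : g (locally_closed I J) p by rewrite E1.
  by rewrite /locally_closed gM gC !ge.
have -> : e I = Order.meet (e I) (e J).
  rewrite -eM//; congr e; apply/funext => a; apply/propext; split=> [Ia|[]//].
  by split=> //; exact: IJ.
by rewrite -meetA meetxC meetx0.
Qed.

End FreeBooleanExtension.

(** * Evaluation of [R[B]] at points, and its order *)

Section BooleanPowers.
Variables (R : realType) (A : balg R).
Variables (dB : Order.disp_t) (B : ctbDistrLatticeType dB) (e : (A -> Prop) -> B).
Variables (S : balg R) (x : B -> S).
Hypothesis Hx : is_RB x.
Variable g : B -> set (bpoint A).
Hypothesis Hg : bool_hom g.
Hypothesis ge : forall I, is_arch_ideal I -> g (e I) = cozero I.
Hypothesis g_faithful : forall b, g b = set0 -> b = Order.bottom.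

(** Since [u * v = 0] for the positive and negative parts, [(u - v)^2 = u^2 + v^2]. *)
Lemma bsqr_ge0 (T : balg R) (a : T) : 0 <<= a * a.
Proof.
rewrite -(pospart_subneg a); set u := pospart a; set v := negpart a.
have -> : (u - v) * (u - v) = u * u + v * v - (u * v) *+ 2 by ring.
rewrite posneg_mul0 mul0rn subr0.
by apply: badd_ge0; apply: bmul_ge0; try exact: pospart_ge0; exact: negpart_ge0.
Qed.

Lemma RBM b c : x (Order.meet b c) = x b * x c.
Proof. by have [[H]] := Hx. Qed.
Lemma RBC b : x (Order.compl b) = 1 - x b.
Proof. by have [[_ _ H]] := Hx. Qed.
Lemma RB0 : x Order.bottom = 0.
Proof. by have [[]] := Hx. Qed.
Lemma RB1 : x Order.top = 1.
Proof. by rewrite -compl0 RBC RB0 subr0. Qed.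
Lemma RB_idem b : x b * x b = x b.
Proof. by rewrite -RBM meetxx. Qed.
Lemma RB_ge0 b : 0 <<= x b.
Proof. by rewrite -RB_idem; exact: bsqr_ge0. Qed.

Definition patom (p : bpoint A) : B := Order.compl (e (pker p)).

Lemma spatial_patom p : g (patom p) = [set p]%classic.
Proof.
have [_ _ gC _ _] := Hg; rewrite /patom gC ge; last exact: pker_arch.
apply/seteqP; split=> [q|_ ->]; last by move=> [a []].
move=> N; apply/esym/pker_inj => a pa; apply: contrapT => qa.
by apply: N; exists a.
Qed.

(** The meet of [b] with the complement of [c] has empty image, so it is bottom by faithfulness. *)
Lemma spatial_meet b c : (g b `<=` g c)%classic -> Order.meet b c = b.
Proof.
have [gM _ gC _ _] := Hg; move=> bc.
have E : Order.meet b (Order.compl c) = Order.bottom.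
  by apply: g_faithful; rewrite gM gC; apply/seteqP; split=> // p [/bc].
by rewrite -[RHS](meetx1 b) -(joinxC c) meetUr E joinx0.
Qed.

Lemma patomI p b : Order.meet b (patom p) =
  if `[<g b p>] then patom p else Order.bottom.
Proof.
have [gM _ gC _ _] := Hg; case: asboolP => gbp.
  by rewrite meetC; apply: spatial_meet => q; rewrite spatial_patom => ->.
apply: g_faithful; rewrite gM spatial_patom; apply/seteqP; split=> // q [gq qp].
by apply: gbp; rewrite -qp.
Qed.

(** The indicator of [p] in [g b] satisfies the relations of [R[B]]; [R^o] is [R] as an algebra over
    itself. *)
Lemma RB_eval_exists (p : bpoint A) : exists h : S -> R^o,
  alg_hom h /\ forall b, h (x b) = if `[<g b p>] then 1 else 0.
Proof.
have [gM gJ gC g0 g1] := Hg; have [_ univ] := Hx.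
have [|//] := univ R^o (fun b => if `[<g b p>] then 1 else 0).
split=> [b c|b c|b|].
- rewrite gM; have -> : `[<(Order.meet (g b) (g c)) p>] = `[<g b p>] && `[<g c p>].
    exact: asbool_and.
  by do 2 case: asboolP => _; rewrite /= ?mulr1 ?mulr0.
- rewrite gJ; have -> : `[<(Order.join (g b) (g c)) p>] = `[<g b p>] || `[<g c p>].
    exact: asbool_or.
  by do 2 case: asboolP => _; rewrite /= ?mulr1 ?mulr0 ?addr0 ?subr0 ?add0r ?addrK.
- rewrite gC; have -> : `[<(Order.compl (g b)) p>] = ~~ `[<g b p>] by exact: asbool_neg.
  by case: asboolP => _; rewrite /= ?subr0 ?subrr.
- by rewrite g0; case: asboolP.
Qed.

(** The pieces may overlap, so closure under operations needs no disjointness; [RB_ge0_eval] makes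
    them disjoint when summing. *)
Inductive piecewise_const (s : S) : B -> Prop :=
| piecewise_one b r : s * x b = r *: x b -> piecewise_const s b
| piecewise_join b c : piecewise_const s b -> piecewise_const s c ->
    piecewise_const s (Order.join b c).

Lemma piecewise_op (op : S -> S -> S) (opR : R -> R -> R) s t b c :
  (forall b r q, s * x b = r *: x b -> t * x b = q *: x b ->
    op s t * x b = opR r q *: x b) ->
  piecewise_const s b -> piecewise_const t c ->
  piecewise_const (op s t) (Order.meet b c).
Proof.
move=> Hop Hs Ht; elim: Hs => [{}b r Hr|b1 b2 _ IH1 _ IH2]; last first.
  by rewrite meetUl; exact: piecewise_join.
elim: Ht => [{}c q Hq|c1 c2 _ IH1 _ IH2]; last first.
  by rewrite meetUr; exact: piecewise_join.
apply: (@piecewise_one _ _ (opR r q)); apply: Hop; rewrite RBM.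
  by rewrite mulrA Hr scalerAl.
by rewrite mulrCA Hq scalerAr.
Qed.

Lemma piecewise_constT s : piecewise_const s Order.top.
Proof.
move: s; apply: (RB_ind _ Hx) => [|b]; last first.
  rewrite -(joinxC b); apply: piecewise_join.
    by apply: (@piecewise_one _ _ 1); rewrite RB_idem scale1r.
  apply: (@piecewise_one _ _ 0); rewrite RBC scale0r mulrBr RB_idem mulr1.
  exact: subrr.
split=> [|r s t /asboolP Hs /asboolP Ht|s t /asboolP Hs /asboolP Ht].
- by apply: asboolT; apply: (@piecewise_one _ _ 1); rewrite scale1r mul1r.
(* Closure of a subalgebra is stated for combinations [r *: s + t]; meets of pieces give a common
   refinement. *)
- apply: asboolT; rewrite -[Order.top]meetxx.
  apply: (@piecewise_op (fun s t => r *: s + t) (fun u v => r * u + v)) Hs Ht.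
  by move=> b u v Hu Hv; rewrite mulrDl -scalerAl Hu Hv scalerA scalerDl.
- apply: asboolT; rewrite -[Order.top]meetxx.
  apply: (@piecewise_op (fun s t => s * t) (fun u v => u * v)) Hs Ht.
  by move=> b u v Hu Hv; rewrite -mulrA Hv -scalerAr Hu scalerA mulrC.
Qed.

Variable h : bpoint A -> S -> R^o.
Hypothesis Hh : forall p, alg_hom (h p).
Hypothesis hx : forall p b, h p (x b) = if `[<g b p>] then 1 else 0.

(** On a piece where [s] equals [r], either the piece is bottom, or evaluation at one of its points
    gives [r >= 0]. *)
Lemma RB_ge0_eval s : (forall p, 0 <= h p s) -> 0 <<= s.
Proof.
move=> H; rewrite -[s]mulr1 -RB1.
elim: (piecewise_constT s) => [b r Hr|b c _ IHb _ IHc].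
  have [/g_faithful ->|/eqP/set0P[p gp]] := pselect (g b = set0).
    by rewrite RB0 mulr0; exact: ble_refl.
  rewrite Hr; apply: bscale_ge0; last exact: RB_ge0.
  have [_ hZ hM _] := Hh p; have := congr1 (h p) Hr.
  rewrite hM hZ hx asboolT// mulr1 => E.
  by rewrite -[r]mulr1 -[r * 1]E.
have [[_ xJ _ _] _] := Hx.
(* The part of [c] already inside [b] is cut off, so that [s] splits into a sum. *)
have -> : s * x (Order.join b c) = s * x b + s * x c * x (Order.compl b).
  by rewrite xJ RBC; ring.
by apply: badd_ge0 => //; apply: bmul_ge0 => //; exact: RB_ge0.
Qed.

(* The endomorphism s |-> h p s x_p + s (1 - x_p) fixes the generators, so it is
   the identity. *)
Lemma RB_mul_atom p s : s * x (patom p) = h p s *: x (patom p).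
Proof.
set y := x (patom p); have yy : y * y = y := RB_idem _.
have [_ univ] := Hx; have [Hx1 _] := Hx.
have [_ uniq] := univ S x Hx1; have [hD hZ hM h1] := Hh p.
have : h p s *: y + s * (1 - y) = s.
  apply: (uniq (fun s => h p s *: y + s * (1 - y)) id) => [||b].
  - split=> [a b|r a|a b|].
    + by rewrite hD scalerDl; ring.
    + by rewrite hZ scalerDr scalerA -scalerAl.
    + have -> : h p (a * b) *: y = (h p a)%:A * (h p b)%:A * y.
        by rewrite hM !mulr_algl scalerA mulr_algl.
      rewrite -[h p a *: y]mulr_algl -[h p b *: y]mulr_algl.
      set u := (h p a)%:A; set v := (h p b)%:A.
      have -> : (u * y + a * (1 - y)) * (v * y + b * (1 - y)) =
        u * v * y + a * b * (1 - y) + (y * y - y) * (u * v - u * b - a * v + a * b).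
        by ring.
      by rewrite yy subrr mul0r addr0.
    + by rewrite h1 scale1r mul1r addrC subrK.
  - by split.
  - rewrite /= hx; have : x b * y = if `[<g b p>] then y else 0.
      by rewrite -RBM patomI; case: ifP => // _; rewrite RB0.
    rewrite mulrBr mulr1 => ->; case: ifP => _.
      by rewrite scale1r addrC subrK.
    by rewrite scale0r add0r subr0.
move=> /(congr1 ( *%R^~ y)); rewrite /= mulrDl -scalerAl yy -mulrA mulrBl yy mul1r.
by rewrite subrr mulr0 addr0 => ->.
Qed.

End BooleanPowers.

(** * Residues at points of elements of the completion *)

Section Completion.
Variables (R : realType) (A : balg R).
Variables (dB : Order.disp_t) (B : ctbDistrLatticeType dB) (e : (A -> Prop) -> B).
Variables (S : balg R) (x : B -> S) (D : balg R) (iota : S -> D).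
Hypothesis Hx : is_RB x.
Hypothesis Hiota : dedekind_completion iota.
Variable g : B -> set (bpoint A).
Hypothesis Hg : bool_hom g.
Hypothesis ge : forall I, is_arch_ideal I -> g (e I) = cozero I.
Hypothesis g_faithful : forall b, g b = set0 -> b = Order.bottom.
Variable h : bpoint A -> S -> R^o.
Hypothesis Hh : forall p, alg_hom (h p).
Hypothesis hx : forall p b, h p (x b) = if `[<g b p>] then 1 else 0.

Implicit Types (p q : bpoint A) (d : D) (r : R).

Lemma bal_morph_le (T1 T2 : balg R) (f : T1 -> T2) a b :
  bal_morph f -> a <<= b -> f a <<= f b.
Proof.
move=> [_ [_ [_ [_ [_ fJ]]]]] ab; have [_ j2 j3] := bjoinP a b.
have <- : bjoin T1 a b = b by apply: ble_anti => //; apply: j3 => //; exact: ble_refl.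
by rewrite fJ; have [] := bjoinP (f a) (f b).
Qed.

Let Hm : bal_morph iota. Proof. by have [] := Hiota. Qed.

Lemma iotaM s t : iota (s * t) = iota s * iota t.
Proof. by have [_ [_ [H _]]] := Hm. Qed.
Lemma iotaZ r s : iota (r *: s) = r *: iota s.
Proof. by have [_ [H _]] := Hm. Qed.
Lemma iota_alg r : iota r%:A = r%:A.
Proof. by have [_ [_ [_ [H _]]]] := Hm; rewrite iotaZ H. Qed.
Lemma iota0 : iota 0 = 0.
Proof. by rewrite -(scale0r (0 : S)) iotaZ scale0r. Qed.

Definition datom p : D := iota (x (patom e p)).

Lemma datom_idem p : datom p * datom p = datom p.
Proof. by rewrite -iotaM (RB_idem Hx). Qed.

Lemma datom_ge0 p : 0 <<= datom p.
Proof. by rewrite -datom_idem; exact: bsqr_ge0. Qed.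

Lemma codatom_ge0 p : 0 <<= 1 - datom p.
Proof.
have -> : 1 - datom p = (1 - datom p) * (1 - datom p).
  by rewrite mulrBr mulr1 mulrBl mul1r datom_idem subrr subr0.
exact: bsqr_ge0.
Qed.

Lemma datom_neq0 p : datom p <> 0.
Proof.
rewrite -iota0; have [_ inj _ _] := Hiota => /inj /(congr1 (h p)).
rewrite hx (spatial_patom Hg ge) asboolT//; have [_ hZ _ _] := Hh p.
by rewrite -(scale0r (0 : S)) hZ scale0r => /eqP; rewrite oner_eq0.
Qed.

Lemma datom_scale_le p r t : r *: datom p <<= t *: datom p -> r <= t.
Proof.
move=> H; rewrite leNgt; apply/negP => tr; apply: (@datom_neq0 p).
apply: ble_anti; last exact: datom_ge0.
have /bsub_ge0 := H; rewrite -scalerBl => H1.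
have rt : 0 < r - t by rewrite subr_gt0.
have := @bscale_ge0 _ _ (r - t)^-1 _ _ H1; rewrite scalerA.
rewrite -(opprB r t) mulrN mulVf ?lt0r_neq0// scaleN1r invr_ge0 ltW// => /(_ isT) /bleN.
by rewrite opprK oppr0.
Qed.

Lemma iota_datom p s : iota s * datom p = h p s *: datom p.
Proof. by rewrite -iotaM (RB_mul_atom Hx Hg ge g_faithful Hh hx) iotaZ. Qed.

Lemma iota_ge0 s : (forall p, 0 <= h p s) -> 0 <<= iota s.
Proof.
by move=> H; rewrite -iota0; apply: (bal_morph_le Hm);
  apply: (RB_ge0_eval Hx g_faithful Hh hx).
Qed.

Lemma datom_update p d y r :
  y <<= d -> y * datom p <<= r *: datom p -> y <<= d * (1 - datom p) + r *: datom p.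
Proof.
move=> yd yr; have -> : y = y * (1 - datom p) + y * datom p by ring.
apply: bleD => //; rewrite mulrC [X in _ <<= X]mulrC.
by apply: bleMl => //; exact: codatom_ge0.
Qed.

(* Replacing the value of d at p by r yields another upper bound of Y. *)
Lemma datom_lub p (Y : D -> Prop) d r : is_lub (ble D) Y d ->
  (forall y, Y y -> y * datom p <<= r *: datom p) -> d * datom p <<= r *: datom p.
Proof.
move=> [dub dlub] H.
have : d <<= d * (1 - datom p) + r *: datom p.
  by apply: dlub => y Yy; apply: datom_update; [exact: dub|exact: H].
move=> /(bleMl (datom_ge0 p)); rewrite mulrDr mulrCA mulrBr mulr1 datom_idem.
by rewrite subrr mulr0 add0r -scalerAr datom_idem mulrC.
Qed.

(** The residue is the supremum of [h p s] over [iota s <<= d]. It is large enough by [datom_lub],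
    since [d] is a join of such [iota s], and not too large because [D] is archimedean. *)
Lemma datom_residue p d : exists r, d * datom p = r *: datom p.
Proof.
have [_ _ _ Hsup] := Hiota; have [X dX] := Hsup d.
pose E : set R := [set r | exists s, iota s <<= d /\ r = h p s]%classic.
have [n [_ dn]] := bbounded d; have [m [_ dm]] := bbounded (- d).
have Xl y : y <<= d -> y * datom p <<= d * datom p.
  by move=> yd; rewrite mulrC [X in _ <<= X]mulrC; apply: bleMl yd; exact: datom_ge0.
have halg r : h p r%:A = r by have [_ hZ _ h1] := Hh p; rewrite hZ h1; exact: mulr1.
have En : ubound E n%:R.
  move=> _ [s [sd ->]]; apply: (@datom_scale_le p); rewrite -iota_datom.
  apply: (ble_trans (Xl _ sd)); rewrite -[X in _ <<= X]mulr_algl balg_nat.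
  by rewrite mulrC [X in _ <<= X]mulrC; apply: bleMl dn; exact: datom_ge0.
have Em : E (- m%:R).
  exists (- m%:R)%:A; split; last by rewrite halg.
  rewrite iota_alg scaleNr balg_nat -[d]opprK; exact: bleN.
have Esup : has_sup E by split; [exists (- m%:R)|exists n%:R].
exists (sup E); apply: ble_anti.
  apply: (datom_lub dX) => _ [s [Xs ->]]; rewrite iota_datom.
  apply/bsub_ge0; rewrite -scalerBl; apply: bscale_ge0; last exact: datom_ge0.
  have /(ub_le_sup (proj2 Esup)) : E (h p s).
    by exists s; split=> //; have [dub _] := dX; apply: dub; exists s.
  by rewrite subr_ge0.
suff : sup E *: datom p - d * datom p <<= 0 by move/(bleDr (d * datom p)); rewrite subrK add0r.
(* An [s] with [h p s] within [1/k] of the supremum bounds [k] times the excess by [datom p]. *)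
apply: (@barch _ _ _ (datom p)) => k k1.
have k0 : 0 < k%:R :> R by rewrite ltr0n.
have [_ [s [sd ->]] hs] := @sup_adherent _ E k%:R^-1 ltac:(by rewrite invr_gt0) Esup.
have H1 := Xl _ sd; rewrite iota_datom in H1.
have H2 : (sup E - k%:R^-1) *: datom p <<= h p s *: datom p.
  apply/bsub_ge0; rewrite -scalerBl; apply: bscale_ge0; last exact: datom_ge0.
  by rewrite subr_ge0 ltW.
have /(bleZ (ltW k0)) := ble_trans H2 H1.
rewrite scalerBl scalerBr [k%:R *: (k%:R^-1 *: _)]scalerA divff ?lt0r_neq0// scale1r.
move=> /(bleDr (datom p - k%:R *: (d * datom p))).
rewrite -scaler_nat scalerBr; congr (_ <<= _); ring.
Qed.

(** * Pointwise computation of algebra, order and bounds in [D] *)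

Variable v : bpoint A -> D -> R.
Hypothesis Hv : forall p d, d * datom p = v p d *: datom p.

Lemma value_uniq p d r : d * datom p = r *: datom p -> v p d = r.
Proof.
rewrite Hv => E; apply/eqP; rewrite eq_le; apply/andP.
by split; apply: (@datom_scale_le p); rewrite E; exact: ble_refl.
Qed.

Lemma value_le p d1 d2 : d1 <<= d2 -> v p d1 <= v p d2.
Proof.
move=> H; apply: (@datom_scale_le p); rewrite -!Hv.
by rewrite mulrC [X in _ <<= X]mulrC; apply: bleMl H; exact: datom_ge0.
Qed.

Lemma valueD p d1 d2 : v p (d1 + d2) = v p d1 + v p d2.
Proof. by apply: value_uniq; rewrite mulrDl !Hv scalerDl. Qed.

Lemma valueZ p r d : v p (r *: d) = r * v p d.
Proof. by apply: value_uniq; rewrite -scalerAl Hv scalerA. Qed.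

Lemma valueM p d1 d2 : v p (d1 * d2) = v p d1 * v p d2.
Proof.
by apply: value_uniq; rewrite -mulrA Hv -scalerAr Hv scalerA mulrC.
Qed.

Lemma value_alg p r : v p r%:A = r.
Proof. by apply: value_uniq; rewrite mulr_algl. Qed.

Lemma value1 p : v p 1 = 1.
Proof. by rewrite -[1]scale1r value_alg. Qed.

Lemma valueN p d : v p (- d) = - v p d.
Proof. by rewrite -scaleN1r valueZ mulN1r. Qed.

Lemma value_iota p s : v p (iota s) = h p s.
Proof. by apply: value_uniq; exact: iota_datom. Qed.

(** The difference [d1 - d2] is a join of elements of [R[B]]; these have nonpositive values, so they
    lie below [0] by positivity in [R[B]]. *)
Lemma ble_values d1 d2 : (forall p, v p d1 <= v p d2) -> d1 <<= d2.
Proof.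
move=> H; suff : d1 - d2 <<= 0 by move=> /(bleDr d2); rewrite subrK add0r.
have {}H p : v p (d1 - d2) <= 0 by rewrite valueD valueN subr_le0.
have [_ _ _ Hsup] := Hiota; have [X [dub dlub]] := Hsup (d1 - d2).
apply: dlub => _ [s [Xs ->]].
have : 0 <<= iota ((-1) *: s).
  apply: iota_ge0 => p; rewrite -value_iota iotaZ valueZ mulN1r oppr_ge0.
  by apply: le_trans (H p); apply: value_le; apply: dub; exists s.
by rewrite iotaZ scaleN1r => /bleN; rewrite opprK oppr0.
Qed.

Lemma values_inj d1 d2 : (forall p, v p d1 = v p d2) -> d1 = d2.
Proof. by move=> H; apply: ble_anti; apply: ble_values => p; rewrite H. Qed.

Lemma value_lub p (Y : D -> Prop) d r : is_lub (ble D) Y d ->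
  (forall y, Y y -> v p y <= r) -> v p d <= r.
Proof.
move=> Yd H; apply: (@datom_scale_le p); rewrite -Hv.
apply: (datom_lub Yd) => y /H yr; rewrite Hv; apply/bsub_ge0.
by rewrite -scalerBl; apply: bscale_ge0 (datom_ge0 p); rewrite subr_ge0.
Qed.

Lemma value_glb p (Y : D -> Prop) d r : is_glb (ble D) Y d ->
  (forall y, Y y -> r <= v p y) -> r <= v p d.
Proof.
move=> [dlb dglb] H; rewrite -lerN2 -valueN.
apply: (@value_lub _ (fun y => Y (- y))) => [|y Yy]; last first.
  by rewrite -[y]opprK valueN lerN2; exact: H.
split=> [y /dlb /bleN|u uub]; first by rewrite opprK.
rewrite -[u]opprK; apply/bleN/dglb => y Yy; rewrite -[y]opprK; apply/bleN/uub.
by rewrite opprK.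
Qed.

Lemma value_join p d1 d2 : v p (bjoin D d1 d2) = Num.max (v p d1) (v p d2).
Proof.
have [j1 j2 j3] := bjoinP d1 d2; apply/eqP; rewrite eq_le; apply/andP; split.
  apply: (@value_lub _ (fun y => y = d1 \/ y = d2)) => [|y [->|->]].
  - split=> [y [->|->]//|u uub].
    by apply: j3; apply: uub; [left|right].
  - by rewrite le_max lexx.
  - by rewrite le_max lexx orbT.
by rewrite ge_max !value_le.
Qed.

Lemma value_meet p d1 d2 : v p (bmeet D d1 d2) = Num.min (v p d1) (v p d2).
Proof. by rewrite bmeetE valueN value_join !valueN -oppr_min opprK. Qed.

(** * The values of [alpha] and the canonical extension properties *)

Lemma value_closed p I : is_arch_ideal I ->
  v p (iota (x (Order.compl (e I)))) = if `[<forall a, I a -> p a = 0>] then 1 else 0.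
Proof.
move=> HI; rewrite value_iota hx; have [_ _ gC _ _] := Hg; rewrite gC ge// complEset.
congr (if _ then _ else _); apply: asbool_equiv_eq; split=> [N a Ia|H [a [Ia]]].
  by apply: contrapT => pa; apply: N; exists a.
by apply; exact: H.
Qed.

Lemma value_datom p q : v q (datom p) = if `[<p = q>] then 1 else 0.
Proof.
rewrite value_closed; last exact: pker_arch.
congr (if _ then _ else _); apply: asbool_equiv_eq; split=> [|<- //].
exact: pker_inj.
Qed.

Lemma value_alpha p a : v p (alpha e x iota a) = p a.
Proof.
rewrite /alpha; set s := epsilon _ _.
have as0 : 0 <<= a + s%:A.
  apply: (epsilon_spec (inhabits (0 : R)) (fun s : R => 0 <<= a + s%:A)).
  have [n [_ an]] := bbounded (- a); exists n%:R; rewrite balg_nat.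
  by have /bsub_ge0 := an; rewrite opprK addrC.
(* At a zero [q] of [I] the negative part vanishes, so [r <= q a + s]; elsewhere the value is [0],
   below [q a + s] by the choice of [s]. *)
have bound y q : alpha_set e x iota a s y -> v q y <= q a + s.
  move=> [r [I [HI In ->]]]; rewrite valueZ value_closed//; case: asboolP => [qI|_].
    have := qI _ In; rewrite point_negpart pointB pointD !point_alg mulr1.
    by move/max_idPr => ?; lra.
  rewrite mulr0; have := point_le q as0.
  by rewrite point0 pointD point_alg.
have [[DC _] _ _ _] := Hiota.
have [||d Hd] := DC (alpha_set e x iota a s).
- exists (0 *: iota (x (Order.compl (e (@arch_top R A))))), 0, (@arch_top R A).
  by split=> //; exact: arch_topP.
- have [n [_ an]] := bbounded (a + s%:A); exists n%:R => y Hy.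
  apply: ble_values => q; apply: (le_trans (bound _ q Hy)).
  by rewrite -balg_nat value_alg; have := point_le q an; rewrite pointD point_alg point_nat.
have {}Hd : is_lub (ble D) (alpha_set e x iota a s) (lubD (alpha_set e x iota a s)).
  by apply: (epsilon_spec (inhabits (0 : D))); exists d.
rewrite valueD valueN value_alg.
suff -> : v p (lubD (alpha_set e x iota a s)) = p a + s by ring.
apply/eqP; rewrite eq_le; apply/andP; split.
  by apply: (value_lub Hd) => y /bound.
(* The bound is attained at [p] by the kernel of [p] with [r = p a + s]. *)
have <- : v p ((p a + s) *: datom p) = p a + s.
  by rewrite valueZ value_datom asboolT// mulr1.
apply: value_le; have [dub _] := Hd; apply: dub.
exists (p a + s), (pker p); split=> //; first exact: pker_arch.
by rewrite /pker point_negpart pointB pointD !point_alg subrr oppr0 maxxx.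
Qed.

Lemma alpha_inj : injective (alpha e x iota).
Proof.
by move=> a b E; apply: points_inj => p; rewrite -!value_alpha E.
Qed.

Lemma alpha_morph : bal_morph (alpha e x iota).
Proof.
split=> [a b|]; first by apply: values_inj => p; rewrite valueD !value_alpha pointD.
split=> [r a|]; first by apply: values_inj => p; rewrite valueZ !value_alpha pointZ.
split=> [a b|]; first by apply: values_inj => p; rewrite valueM !value_alpha pointM.
split; first by apply: values_inj => p; rewrite value1 value_alpha point1.
split=> a b; apply: values_inj => p.
  by rewrite value_meet !value_alpha point_meet.
by rewrite value_join !value_alpha point_join.
Qed.

(* The function with value t at p and t' elsewhere is the meet of the
   elements of A above it, because points of A can be separated. *)
Lemma spike_glb p (t t' : R) : t' <= t ->
  is_glb (ble D) (Defs.image (alpha e x iota)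
    (fun a => (t - t') *: datom p + t'%:A <<= alpha e x iota a))
    ((t - t') *: datom p + t'%:A).
Proof.
move=> tt'; split=> [_ [a [Ha ->]]//|u ulb]; apply: ble_values => q.
have spikeE q' : v q' ((t - t') *: datom p + t'%:A) = if `[<p = q'>] then t else t'.
  rewrite valueD valueZ value_alg value_datom; case: ifP => _; first by rewrite mulr1 subrK.
  by rewrite mulr0 add0r.
have below a : (forall q', (if `[<p = q'>] then t else t') <= q' a) -> v q u <= q a.
  move=> Ha; rewrite -value_alpha; apply: value_le; apply: ulb; exists a; split=> //.
  by apply: ble_values => q'; rewrite spikeE value_alpha.
rewrite spikeE; case: asboolP => [_|pq].
  have := below t%:A; rewrite point_alg; apply=> q'; rewrite point_alg.
  by case: ifP.
have [c [qc pc]] : exists c, q c = 0 /\ p c <> 0.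
  apply: contrapT => N; apply: pq; apply/esym/pker_inj => c qc.
  by apply: contrapT => pc; apply: N; exists c.
(* As [c] vanishes at [q] but not at [p], this element is [t] at [p], [t'] at [q], and at least [t']
   everywhere. *)
have := below (((t - t') / (p c * p c)) *: (c * c) + t'%:A).
rewrite pointD pointZ pointM qc mulr0 mulr0 add0r point_alg; apply=> q'.
have c0 : 0 <= (t - t') / (p c * p c).
  by rewrite divr_ge0 ?subr_ge0// -expr2 sqr_ge0.
rewrite pointD pointZ pointM point_alg; case: asboolP => [<-|_].
  by rewrite divfK ?subrK// mulf_neq0//; exact/eqP.
by rewrite lerDr mulr_ge0// -expr2 sqr_ge0.
Qed.

(** [d] is the join over all [p] of the spikes equal to [v p d] at [p] and to a global lower bound
    of [d] elsewhere; [spike_glb] makes each a meet from [A]. *)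
Lemma alpha_dense : dense_emb (alpha e x iota).
Proof.
move=> d; have [n [_ dn]] := bbounded (- d).
have dge p : - n%:R <= v p d.
  by rewrite -lerN2 opprK -valueN -(value_alg p n%:R) balg_nat; exact: value_le.
pose spike p := (v p d - - n%:R) *: datom p + (- n%:R)%:A.
exists (fun y => exists p, y = spike p); split; last first.
  move=> _ [p ->]; exists (fun a => spike p <<= alpha e x iota a).
  exact: spike_glb.
have spikeE p q : v q (spike p) = if `[<p = q>] then v p d else - n%:R.
  rewrite valueD valueZ value_alg value_datom; case: ifP => _; first by rewrite mulr1 subrK.
  by rewrite mulr0 add0r.
split=> [_ [p ->]|u uub]; apply: ble_values => q.
  by rewrite spikeE; case: asboolP => // ->.
have /(value_le q) : spike q <<= u by apply: uub; exists q.
by rewrite spikeE asboolT.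
Qed.

Lemma alpha_compact : compact_emb (alpha e x iota).
Proof.
move=> Y T eps m j eps0 Ym Tj mj.
(* Spending [eps / 2] on each side of the gap between [m] and [j] makes the inequality strict. *)
have cover p : exists s t, [/\ Y s, T t & p s < p t].
  have pmj := value_le p mj; rewrite valueD value_alg in pmj.
  have [t [Tt jt]] : exists t, T t /\ v p j - eps / 2 < p t.
    apply: contrapT => N; suff : v p j <= v p j - eps / 2 by lra.
    apply: (value_lub Tj) => _ [t [Tt ->]]; rewrite value_alpha leNgt.
    by apply/negP => jt; apply: N; exists t.
  have [s [Ys ms]] : exists s, Y s /\ p s < v p m + eps / 2.
    apply: contrapT => N; suff : v p m + eps / 2 <= v p m by lra.
    apply: (value_glb Ym) => _ [s [Ys ->]]; rewrite value_alpha leNgt.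
    by apply/negP => ms; apply: N; exists s.
  by exists s, t; split=> //; lra.
pose ok (c : seq (A * A)) := forall u, u \in c -> Y u.1 /\ T u.2.
(* The ideal [J] below is generated by the elements [(t - s)^+]. By [cover] no point kills it, so it
   contains [1], and a finite list [c] gives [1 <<= gap c]. *)
pose gap (c : seq (A * A)) : A := \sum_(u <- c) pospart (u.2 - u.1).
pose G w := exists c, ok c /\ w = gap c.
pose J a := exists w, G w /\ babs a <<= w.
have HJ : is_lideal J.
  apply: cone_lideal; first by exists [::]; rewrite /gap big_nil.
  move=> _ _ [c [okc ->]] [c' [okc' ->]]; exists (c ++ c'); split; last by rewrite /gap big_cat.
  by move=> u; rewrite mem_cat => /orP[/okc|/okc'].
have [[_ [[c [okc ->]]]]|nJ1] := pselect (J 1); last first.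
  have [p pJ] := point_exists HJ nJ1; have [s [t [Ys Tt st]]] := cover p.
  have /pJ : J (pospart (t - s)).
    exists (pospart (t - s)); split; last by rewrite bge0_abs; [exact: ble_refl|exact: pospart_ge0].
    exists [:: (s, t)]; rewrite /gap big_seq1; split=> // u.
    by rewrite inE => /eqP ->.
  by rewrite point_join pointB point0; case: leP => ? ?; lra.
rewrite bge0_abs; last exact: ble01.
(* [s0] and [t0] only seed the folds; the pairs from [c] do the work. *)
move=> gap1; have [p0 _] := point_inhabited A; have [s0 [t0 [Ys0 Tt0 _]]] := cover p0.
exists s0, (map fst c), t0, (map snd c); split=> //.
- by move=> _ /mapP[u /okc[Yu _] ->].
- by move=> _ /mapP[u /okc[_ Tu] ->].
apply: ble_points => p.
(* Otherwise every summand of [gap c] vanishes at [p], against [1 <<= gap c]. Then the finite meet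
   lies below [u.1], and the finite join above [u.2], at [p]. *)
have [u uc pu] : exists2 u, u \in c & p u.1 < p u.2.
  apply: contrapT => N; have := point_le p gap1; rewrite point1.
  suff -> : p (gap c) = 0 by rewrite leNgt ltr01.
  have {}N u : u \in c -> p u.2 <= p u.1.
    by move=> uc; rewrite leNgt; apply/negP => pu; apply: N; exists u.
  rewrite /gap; elim: c N {okc gap1} => [|u c IH] N; first by rewrite big_nil point0.
  rewrite big_cons pointD IH ?addr0 => [|w wc]; last by apply: N; rewrite inE wc orbT.
  rewrite point_join pointB point0; apply/max_idPr; rewrite subr_le0.
  by apply: N; rewrite inE eqxx.
apply: (@le_trans _ _ (p u.1)).
  rewrite /fin_meet; elim: c uc {okc gap1} => //= w c IH; rewrite inE.
  move=> /orP[/eqP <-|/IH H]; rewrite point_meet ge_min ?lexx//.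
  by rewrite H orbT.
apply: (le_trans (ltW pu)).
rewrite /fin_join; elim: c uc {okc gap1} => //= w c IH; rewrite inE.
move=> /orP[/eqP <-|/IH H]; rewrite point_join le_max ?lexx//.
by rewrite H orbT.
Qed.

End Completion.

Theorem mainTheorem10 (R : realType) (A : balg R)
    (dB : Order.disp_t) (B : ctbDistrLatticeType dB) (e : (A -> Prop) -> B)
    (S : balg R) (x : B -> S) (D : balg R) (iota : S -> D) :
  free_bool_ext e -> is_RB x -> dedekind_completion iota ->
  canonical_extension (alpha e x iota).
Proof.
move=> He Hx Hiota.
have [g [Hg ge gf]] := free_bool_ext_spatial He.
have /choice[h Hh] : forall p, exists h : S -> R^o,
    alg_hom h /\ forall b, h (x b) = if `[<g b p>] then 1 else 0.
  by move=> p; exact: RB_eval_exists.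
have Hh1 p : alg_hom (h p) := (Hh p).1.
have Hh2 p : forall b, h p (x b) = if `[<g b p>] then 1 else 0 := (Hh p).2.
have /choice[v Hv] : forall p, exists v : D -> R,
    forall d, d * datom e x iota p = v d *: datom e x iota p.
  move=> p; have /choice[v Hv] := datom_residue Hx Hiota Hg ge gf Hh1 Hh2 p.
  by exists v.
split; first by have [] := Hiota.
- exact: (alpha_inj Hx Hiota Hg ge gf Hh1 Hh2 Hv).
- exact: (alpha_morph Hx Hiota Hg ge gf Hh1 Hh2 Hv).
- exact: (alpha_dense Hx Hiota Hg ge gf Hh1 Hh2 Hv).
- exact: (alpha_compact Hx Hiota Hg ge gf Hh1 Hh2 Hv).
Qed.
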